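(* Let $\Sigma$ be a CAMC surface (surface with constant anisotropic mean curvature $\Lambda$) of the Dirichlet energy in $\mathbb{R}^3$. Assume that $\Sigma$ is foliated by circles contained in planes parallel to the $xy$-plane. \begin{enumerate} \item If $\Lambda\neq 0$, then $\Sigma$ is a surface of revolution about an axis parallel to the $z$-axis. \item If $\Lambda=0$, then $\Sigma$ is a surface of revolution about an axis parallel to the $z$-axis (a horizontal plane $z=c$ or $z=c\log(\sqrt{x^2+y^2})$, $c\neq 0$), or the surface is parametrized by $$X(s,\theta)=(a(s),b(s),s)+r(s)(\cos\theta,\sin\theta,0),$$ where there are three types of families of surfaces. After translations of $\mathbb{R}^3$, they are the following: \begin{enumerate} \item Type I: $$r(s)=\frac{c}{\sqrt{\lambda^2+\mu^2}\,\cos(cs)},\quad a(s)=\frac{c\lambda\tan(cs)}{\lambda^2+\mu^2},\quad b(s)=\frac{c\mu\tan(cs)}{\lambda^2+\mu^2}.$$ \item Type II: $$r(s)=\frac{1}{\sqrt{\lambda^2+\mu^2}\,s+c},\quad a(s)=-\frac{\lambda}{(\lambda^2+\mu^2)s+c\sqrt{\lambda^2+\mu^2}},\quad b(s)=-\frac{\mu}{(\lambda^2+\mu^2)s+c\sqrt{\lambda^2+\mu^2}}.$$ \item Type III: $$r(s)=\frac{c}{\sqrt{\lambda^2+\mu^2}\,\sinh(cs)},\quad a(s)=-\frac{c\lambda\coth(cs)}{\lambda^2+\mu^2},\quad b(s)=-\frac{c\mu\coth(cs)}{\lambda^2+\mu^2}.$$ \end{enumerate} For all these solutions, $c,\lambda,\mu\in\mathbb{R}$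 with $c\neq 0$ and $\lambda^2+\mu^2\neq 0$. The domain $I\subset\mathbb{R}$ of $s$ is such that the functions $r$, $a$ and $b$ make sense. In the three cases, all surfaces are embedded and the curve of centers $s\mapsto(a(s),b(s),s)$ is included in a vertical plane, which is a plane of symmetry of the surface. \end{enumerate}
   Context: Let $\Sigma$ be an oriented surface immersed in Euclidean space $\mathbb{R}^3$ (coordinates $(x,y,z)$) with unit normal $\nu=(\nu_1,\nu_2,\nu_3)$. The Dirichlet energy of $\Sigma$ is $\mathcal{F}(\Sigma)=\int_\Sigma F(\nu)\,d\Sigma$ with $F(\nu)=\frac{1}{\nu_3}-\nu_3$, where it is understood that $\nu_3\neq 0$; if $\Sigma$ is the graph $z=u(x,y)$ over $\Omega\subset\mathbb{R}^2$, this equals $\int_\Omega|Du|^2$. The anisotropic mean curvature of $\Sigma$ is $\Lambda=2HF-\mathrm{div}_\Sigma DF$, where $H$ is the mean curvature of $\Sigma$ and $DF$ is the gradient of $F$ on the unit sphere $\mathbb{S}^2$. $\Sigma$ is a CAMC (stationary) surface if $\Lambda$ is constant. For a graph $z=u(x,y)$, the condition of having constant anisotropic mean curvature $\Lambda$ reads $u_{xx}+u_{yy}=\Lambda/2$. The foliation is by a smooth one-parameter family of circles, which need not have the same radius. In the parametrization, $s\in I$, $\theta\in\mathbb{R}$, and the circle at height $s$ has center $(a(s),b(s),s)$ and radius $r(s)>0$. *)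

(* Defs.v *)
From Stdlib Require Import Reals ZArith.
From Coquelicot Require Import Coquelicot.
Open Scope R_scope.

(** * Vectors of Euclidean space *)

Definition V3 : Type := (R * R * R)%type.

Definition vx (p : V3) : R := fst (fst p).
Definition vy (p : V3) : R := snd (fst p).
Definition vz (p : V3) : R := snd p.

Definition vzero : V3 := (0, 0, 0).
Definition vadd (p q : V3) : V3 := (vx p + vx q, vy p + vy q, vz p + vz q).
Definition vscal (k : R) (p : V3) : V3 := (k * vx p, k * vy p, k * vz p).
Definition vsub (p q : V3) : V3 := vadd p (vscal (-1) q).
Definition dot (p q : V3) : R := vx p * vx q + vy p * vy q + vz p * vz q.
Definition cross (p q : V3) : V3 :=
  (vy p * vz q - vz p * vy q,
   vz p * vx q - vx p * vz q,
   vx p * vy q - vy p * vx q).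
Definition vnorm (p : V3) : R := sqrt (dot p p).

(** * Parametrized surfaces

    A surface is a map [X : R -> R -> V3], considered on the domain
    [{(t, th) | lo < t < hi}]. *)

Definition in_itv (lo hi : Rbar) (t : R) : Prop := Rbar_lt lo t /\ Rbar_lt t hi.

Definition smooth_on (lo hi : Rbar) (f : R -> R) : Prop :=
  forall t, in_itv lo hi t -> forall n : nat, ex_derive_n f n t.

Definition d1 (X : R -> R -> V3) (t th : R) : V3 :=
  (Derive (fun u => vx (X u th)) t,
   Derive (fun u => vy (X u th)) t,
   Derive (fun u => vz (X u th)) t).

Definition d2 (X : R -> R -> V3) (t th : R) : V3 :=
  (Derive (fun u => vx (X t u)) th,
   Derive (fun u => vy (X t u)) th,
   Derive (fun u => vz (X t u)) th).

Definition immersed (lo hi : Rbar) (X : R -> R -> V3) : Prop :=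
  forall t th, in_itv lo hi t -> cross (d1 X t th) (d2 X t th) <> vzero.

Definition normal (X : R -> R -> V3) (t th : R) : V3 :=
  let n := cross (d1 X t th) (d2 X t th) in vscal (/ vnorm n) n.

Definition g11 (X : R -> R -> V3) (t th : R) : R := dot (d1 X t th) (d1 X t th).
Definition g12 (X : R -> R -> V3) (t th : R) : R := dot (d1 X t th) (d2 X t th).
Definition g22 (X : R -> R -> V3) (t th : R) : R := dot (d2 X t th) (d2 X t th).
Definition detg (X : R -> R -> V3) (t th : R) : R :=
  g11 X t th * g22 X t th - g12 X t th ^ 2.

(** Mean curvature: half the trace of the second fundamental form
    [<d_i d_j X, nu>] with respect to the metric. *)
Definition mean_curvature (X : R -> R -> V3) (t th : R) : R :=
  let nu := normal X t th in
  (g22 X t th * dot (d1 (d1 X) t th) nu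
   - 2 * g12 X t th * dot (d2 (d1 X) t th) nu
   + g11 X t th * dot (d2 (d2 X) t th) nu) / (2 * detg X t th).

(** Surface divergence [sum_ij g^ij <d_i V, d_j X>] of an [R^3]-valued field
    along the surface. *)
Definition surface_div (X V : R -> R -> V3) (t th : R) : R :=
  (g22 X t th * dot (d1 V t th) (d1 X t th)
   - g12 X t th * (dot (d1 V t th) (d2 X t th) + dot (d2 V t th) (d1 X t th))
   + g11 X t th * dot (d2 V t th) (d2 X t th)) / detg X t th.

(** * Anisotropic mean curvature *)

Definition grad (F : V3 -> R) (p : V3) : V3 :=
  (Derive (fun u => F (u, vy p, vz p)) (vx p),
   Derive (fun u => F (vx p, u, vz p)) (vy p),
   Derive (fun u => F (vx p, vy p, u)) (vz p)).

(** Gradient at [n], a point of the unit sphere, of the restriction of [F] to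
    the sphere: the tangential part of the Euclidean gradient. *)
Definition sphere_grad (F : V3 -> R) (n : V3) : V3 :=
  vsub (grad F n) (vscal (dot (grad F n) n) n).

Definition anisotropic_mean_curvature
    (F : V3 -> R) (X : R -> R -> V3) (t th : R) : R :=
  2 * mean_curvature X t th * F (normal X t th)
  - surface_div X (fun u v => sphere_grad F (normal X u v)) t th.

Definition dirichlet (nu : V3) : R := / vz nu - vz nu.

(** The integrand [dirichlet] is undefined where the tangent plane is vertical.
    The points where it is defined are required to be dense, and the
    anisotropic mean curvature to be equal to [Lambda] at all of them.  Isolated
    vertical tangent planes must be tolerated: two of the families below have
    one or two of them along each circle. *)
Definition CAMC (lo hi : Rbar) (X : R -> R -> V3) (Lambda : R) : Prop :=
  (forall t th eps, in_itv lo hi t -> 0 < eps ->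
     exists t' th', in_itv lo hi t' /\ Rabs (t' - t) < eps /\
       Rabs (th' - th) < eps /\ vz (normal X t' th') <> 0) /\
  (forall t th, in_itv lo hi t -> vz (normal X t th) <> 0 ->
     anisotropic_mean_curvature dirichlet X t th = Lambda).

(** * Surfaces foliated by horizontal circles *)

Definition circles (a b h r : R -> R) (t th : R) : V3 :=
  vadd (a t, b t, h t) (vscal (r t) (cos th, sin th, 0)).

(** The height [h t] is an arbitrary smooth function of the parameter of the
    family, so that regions of horizontal planes ([h] constant) and surfaces
    whose height has critical circles are included. *)
Definition foliated_by_circles (lo hi : Rbar) (a b h r : R -> R) : Prop :=
  Rbar_lt lo hi /\
  smooth_on lo hi a /\ smooth_on lo hi b /\
  smooth_on lo hi h /\ smooth_on lo hi r /\
  (forall t, in_itv lo hi t -> 0 < r t) /\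
  immersed lo hi (circles a b h r).

(** * Point sets in space *)

Definition trace (lo hi : Rbar) (X : R -> R -> V3) (p : V3) : Prop :=
  exists t th, in_itv lo hi t /\ p = X t th.

Definition translate (v : V3) (S : V3 -> Prop) (p : V3) : Prop := S (vsub p v).

Definition rotate_vertical (x0 y0 phi : R) (p : V3) : V3 :=
  (x0 + (vx p - x0) * cos phi - (vy p - y0) * sin phi,
   y0 + (vx p - x0) * sin phi + (vy p - y0) * cos phi,
   vz p).

Definition revolution_about (x0 y0 : R) (S : V3 -> Prop) : Prop :=
  forall phi p, S p -> S (rotate_vertical x0 y0 phi p).

Definition horizontal_plane (c : R) (p : V3) : Prop := vz p = c.

Definition log_surface (c : R) (p : V3) : Prop :=
  (vx p, vy p) <> (0, 0) /\ vz p = c * ln (sqrt (vx p ^ 2 + vy p ^ 2)).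

Definition subset (S T : V3 -> Prop) : Prop := forall p, S p -> T p.
Definition same_set (S T : V3 -> Prop) : Prop := forall p, S p <-> T p.

(** The vertical plane [al x + be y = de], with [(al, be) <> (0, 0)]. *)
Definition vertical_plane (al be de : R) (p : V3) : Prop :=
  al * vx p + be * vy p = de.

Definition reflect_vertical (al be de : R) (p : V3) : V3 :=
  vsub p (vscal (2 * (al * vx p + be * vy p - de) / (al ^ 2 + be ^ 2))
                (al, be, 0)).

Definition symmetric_about (al be de : R) (S : V3 -> Prop) : Prop :=
  forall p, S p -> S (reflect_vertical al be de p).

(** [X], assumed [2 PI]-periodic in its second variable, induces an embedding of
    the annulus [(lo, hi) x R / 2 PI Z]: it is an injective immersion with
    continuous inverse on its image. *)
Definition embedded (lo hi : Rbar) (X : R -> R -> V3) : Prop :=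
  immersed lo hi X /\
  (forall s th s' th', in_itv lo hi s -> in_itv lo hi s' ->
     X s th = X s' th' ->
     s = s' /\ exists k : Z, th' = th + 2 * IZR k * PI) /\
  (forall s th eps, in_itv lo hi s -> 0 < eps ->
     exists delta, 0 < delta /\
       forall s' th', in_itv lo hi s' ->
         vnorm (vsub (X s' th') (X s th)) < delta ->
         Rabs (s' - s) < eps /\
         exists k : Z, Rabs (th' + 2 * IZR k * PI - th) < eps).

(** * The three families *)

Inductive solution_type : Set := TypeI | TypeII | TypeIII.

Definition coth (x : R) : R := cosh x / sinh x.

Definition radius (T : solution_type) (c lam mu s : R) : R :=
  match T with
  | TypeI => c / (sqrt (lam ^ 2 + mu ^ 2) * cos (c * s))
  | TypeII => 1 / (sqrt (lam ^ 2 + mu ^ 2) * s + c)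
  | TypeIII => c / (sqrt (lam ^ 2 + mu ^ 2) * sinh (c * s))
  end.

Definition center_x (T : solution_type) (c lam mu s : R) : R :=
  match T with
  | TypeI => c * lam * tan (c * s) / (lam ^ 2 + mu ^ 2)
  | TypeII =>
      - (lam / ((lam ^ 2 + mu ^ 2) * s + c * sqrt (lam ^ 2 + mu ^ 2)))
  | TypeIII => - (c * lam * coth (c * s) / (lam ^ 2 + mu ^ 2))
  end.

Definition center_y (T : solution_type) (c lam mu s : R) : R :=
  match T with
  | TypeI => c * mu * tan (c * s) / (lam ^ 2 + mu ^ 2)
  | TypeII =>
      - (mu / ((lam ^ 2 + mu ^ 2) * s + c * sqrt (lam ^ 2 + mu ^ 2)))
  | TypeIII => - (c * mu * coth (c * s) / (lam ^ 2 + mu ^ 2))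
  end.

(** Where the three functions above make sense.  Their common domain is not cut
    down to [radius > 0]: where [radius] is negative the parametrized circle has
    radius [- radius], and the halves [radius < 0] of types II and III are the
    solutions whose circles grow with the height. *)
Definition in_domain (T : solution_type) (c lam mu s : R) : Prop :=
  match T with
  | TypeI => cos (c * s) <> 0
  | TypeII => sqrt (lam ^ 2 + mu ^ 2) * s + c <> 0
  | TypeIII => sinh (c * s) <> 0
  end.

Definition family_surface (T : solution_type) (c lam mu : R) : R -> R -> V3 :=
  circles (center_x T c lam mu) (center_y T c lam mu) (fun s => s)
          (radius T c lam mu).

Definition admissible (T : solution_type) (c lam mu : R) (lo hi : Rbar) : Prop :=
  c <> 0 /\ lam ^ 2 + mu ^ 2 <> 0 /\ Rbar_lt lo hi /\
  forall s, in_itv lo hi s -> in_domain T c lam mu s.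

(* Main.v *)
Require Import Defs.
From Stdlib Require Import Reals ZArith.
From Coquelicot Require Import Coquelicot.
From Stdlib Require Import Lra Lia Ranalysis5 Classical.
Open Scope R_scope.

(** Write the circle at parameter [t] as
    [(a + r cos th, b + r sin th, h)] and put [w = a' cos th + b' sin th + r'].
    The anisotropic mean curvature is a rational function of the data: constancy
    equal to [Lambda] reads
      [2 (r (h'' w - h' w_t) + h' (w_th^2 + w^2)) = Lambda r w^3],
    where the left side is a trigonometric polynomial of degree 1 in [th].  If
    [Lambda <> 0], the third harmonic of [w^3] forces [a' = b' = 0].  If
    [Lambda = 0], the harmonics 0 and 1 give three ODEs, with first integrals
    [lam = a'/(r^2 h')], [mu = b'/(r^2 h')] and
    [E = (r'^2 - a'^2 - b'^2)/(r h')^2]; the last one, read projectively,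
    shows that [h'] vanishes identically or nowhere.  In the latter case, with
    the height as parameter, [rho = 1/r] satisfies [rho'' = E rho] and
    [rho'^2 - E rho^2 = lam^2 + mu^2].  The sign of [E] decides between types
    I, II, III, and [lam = mu = 0] gives the logarithmic surfaces. *)


(** * The anisotropic mean curvature of a family of circles *)

(** Two features of the hypotheses shape the proof. The anisotropic curvature is undefined where the
    tangent plane is vertical, that is where [w = 0]; multiplied by [r * w ^ 3], the equation is
    polynomial in the data and in [(cos th, sin th)], so it extends to these points by continuity.
    And [h] may have critical points, so the height cannot serve as parameter from the outset; where
    [h' = 0], the immersion condition forces [r'^2 - a'^2 - b'^2] to be nonzero, which keeps the
    projective form of [E] meaningful.

    The first integrals come from the case [h' = 1]: the first harmonics then read
    [r a'' = 2 r' a'], and the same for [b], so [a' / r^2] and [b' / r^2] are constant; the mean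
    value reads [r r'' = r'^2 + a'^2 + b'^2]. Combining the three equations with weights [r'],
    [-a'], [-b'] shows that the Lorentzian square of [(r', a', b')], divided by [r^2], is constant.

    The models have a [radius] of either sign, the given one is positive. A sign [e] with
    [e * e = 1] is carried through the integration and finally absorbed by a half turn in [th]. *)

Definition jet2 (f f1 : R -> R) (f2 t : R) : Prop :=
  locally t (fun u => is_derive f u (f1 u)) /\ is_derive f1 t f2.

Lemma V3_eq (x y z x' y' z' : R) :
  x = x' -> y = y' -> z = z' -> ((x, y, z) : V3) = (x', y', z').
Proof. now intros -> -> ->. Qed.

Lemma cos2_sin2 (th : R) : cos th * cos th + sin th * sin th = 1.
Proof. generalize (sin2_cos2 th); unfold Rsqr; lra. Qed.

(** [auto_derive] leaves terms [Derive (fun u => f u) x]; the detour through [exact] matches them up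
    to eta, and [try] lets a fact be offered even where it does not occur. *)
Ltac rewrite_derive H :=
  match type of H with
  | is_derive ?f ?x ?l =>
      let E := fresh in
      assert (E : Derive (fun u => f u) x = l) by exact (is_derive_unique _ _ _ H);
      cbv beta in E; try rewrite E; clear E
  end.

(** The formula for [Y] is required only near the point, because the formulas for the gradient field
    and for the derivatives of the surface are known only where [w] does not vanish and the data are
    differentiable. *)
Lemma d1_eq (Y : R -> R -> V3) (p q s : R -> R) (p' q' s' t th : R) :
  locally t (fun u => Y u th = (p u, q u, s u)) ->
  is_derive p t p' -> is_derive q t q' -> is_derive s t s' ->
  Defs.d1 Y t th = (p', q', s').
Proof.
  intros HY Hp Hq Hs.
  assert (HD : forall (k : V3 -> R) (f : R -> R) f',
    (forall u, k (p u, q u, s u) = f u) -> is_derive f t f' ->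
    Derive (fun u => k (Y u th)) t = f').
  { intros k f f' Hk Hf; apply is_derive_unique.
    apply is_derive_ext_loc with f; [|exact Hf].
    generalize HY; apply filter_imp; intros u ->; now rewrite Hk. }
  unfold Defs.d1; apply V3_eq; eapply HD; try eassumption; reflexivity.
Qed.

Lemma d2_eq (Y : R -> R -> V3) (p q s : R -> R) (p' q' s' t th : R) :
  locally th (fun v => Y t v = (p v, q v, s v)) ->
  is_derive p th p' -> is_derive q th q' -> is_derive s th s' ->
  Defs.d2 Y t th = (p', q', s').
Proof. exact (d1_eq (fun v u => Y u v) p q s p' q' s' th t). Qed.

Section Curvature.
Variables (a b h r a1 b1 h1 r1 : R -> R) (a2 b2 h2 r2 : R).
Let X := circles a b h r.
(** [w] and [be] are the components of the velocity [X_t] along the radial direction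
    [(cos th, sin th, 0)] and the tangential direction [(- sin th, cos th, 0)] of the circle; [be]
    is also the derivative of [w] in [th]. *)
Let w (t th : R) : R := a1 t * cos th + b1 t * sin th + r1 t.
Let be (t th : R) : R := b1 t * cos th - a1 t * sin th.

Lemma circles_d1 (t th : R) :
  is_derive a t (a1 t) -> is_derive b t (b1 t) ->
  is_derive h t (h1 t) -> is_derive r t (r1 t) ->
  Defs.d1 X t th = (a1 t + r1 t * cos th, b1 t + r1 t * sin th, h1 t).
Proof.
  intros Ha Hb Hh Hr.
  unfold Defs.d1, X, circles, vadd, vscal, vx, vy, vz; simpl.
  apply V3_eq; apply is_derive_unique; auto_derive;
    try (repeat split; eexists; eassumption);
    rewrite_derive Ha; rewrite_derive Hb; rewrite_derive Hh; rewrite_derive Hr; ring.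
Qed.

Lemma circles_d2 (t th : R) :
  Defs.d2 X t th = (- r t * sin th, r t * cos th, 0).
Proof.
  unfold Defs.d2, X, circles, vadd, vscal, vx, vy, vz; simpl.
  apply V3_eq; apply is_derive_unique; auto_derive; trivial; ring.
Qed.

Lemma circles_cross (t th : R) :
  is_derive a t (a1 t) -> is_derive b t (b1 t) ->
  is_derive h t (h1 t) -> is_derive r t (r1 t) ->
  cross (Defs.d1 X t th) (Defs.d2 X t th)
  = (r t * (- h1 t * cos th), r t * (- h1 t * sin th), r t * w t th).
Proof.
  intros Ha Hb Hh Hr.
  rewrite circles_d1, circles_d2 by trivial.
  unfold cross, vx, vy, vz, w; simpl.
  apply V3_eq; try ring.
  transitivity (r t * (a1 t * cos th + b1 t * sin th
    + r1 t * (cos th * cos th + sin th * sin th))); [ring|].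
  rewrite cos2_sin2; ring.
Qed.

(** Dividing by the norm leaves [r / |r|], the sign of [r t]; it is kept because the three families
    contain circles of negative [radius]. *)
Lemma circles_normal (t th : R) :
  is_derive a t (a1 t) -> is_derive b t (b1 t) ->
  is_derive h t (h1 t) -> is_derive r t (r1 t) -> r t <> 0 ->
  let q := sign (r t) / sqrt (h1 t ^ 2 + w t th ^ 2) in
  normal X t th = (- h1 t * cos th * q, - h1 t * sin th * q, w t th * q).
Proof.
  intros Ha Hb Hh Hr r0 q.
  unfold normal; rewrite circles_cross by trivial.
  assert (Hn : vnorm (r t * (- h1 t * cos th), r t * (- h1 t * sin th), r t * w t th)
    = Rabs (r t) * sqrt (h1 t ^ 2 + w t th ^ 2)).
  { unfold vnorm, dot, vx, vy, vz; simpl.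
    rewrite <- sqrt_Rsqr_abs, <- sqrt_mult_alt by apply Rle_0_sqr.
    f_equal; unfold Rsqr.
    transitivity (r t * r t * (h1 t * h1 t * (cos th * cos th + sin th * sin th)
      + w t th * w t th)); [ring|rewrite cos2_sin2; ring]. }
  assert (Hs : sign (r t) = r t * / Rabs (r t)).
  { unfold Rabs; destruct (Rcase_abs (r t)) as [Hc|Hc].
    - rewrite sign_eq_m1 by trivial; field; trivial.
    - rewrite sign_eq_1 by lra; field; trivial. }
  cbv zeta; rewrite Hn, Rinv_mult; unfold vscal, vx, vy, vz; cbn [fst snd].
  unfold q, Rdiv; rewrite Hs; apply V3_eq; ring.
Qed.

Lemma normal_vz (t th : R) :
  is_derive a t (a1 t) -> is_derive b t (b1 t) ->
  is_derive h t (h1 t) -> is_derive r t (r1 t) -> r t <> 0 ->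
  vz (normal X t th) <> 0 <-> w t th <> 0.
Proof.
  intros Ha Hb Hh Hr r0.
  rewrite circles_normal by trivial; unfold vz; cbn [fst snd].
  split; intros H0 H.
  - apply H0; rewrite H; ring.
  - assert (0 < sqrt (h1 t ^ 2 + w t th ^ 2)) by (apply sqrt_lt_R0; nra).
    apply Rmult_integral in H; destruct H as [H|H]; [easy|].
    apply Rmult_integral in H; destruct H as [H|H].
    + assert (Hz : sign (r t) <> 0); [|easy].
      destruct (Rdichotomy _ _ r0); [rewrite sign_eq_m1|rewrite sign_eq_1]; lra.
    + apply Rinv_neq_0_compat in H; [easy|lra].
Qed.

Lemma sphere_grad_dirichlet n :
  vz n <> 0 ->
  sphere_grad dirichlet n
  = ((/ vz n + vz n) * vx n, (/ vz n + vz n) * vy n,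
     (vz n ^ 2 - / vz n ^ 2)).
Proof.
  intro z0.
  assert (Hg : grad dirichlet n = (0, 0, - / vz n ^ 2 - 1)).
  { unfold grad, dirichlet; apply V3_eq.
    (* [dirichlet] ignores the first two coordinates, so the differentiated functions are constant
       up to conversion. *)
    - exact (Derive_const (/ vz n - vz n) _).
    - exact (Derive_const (/ vz n - vz n) _).
    - apply is_derive_unique; unfold vz; simpl; auto_derive; [exact z0|].
      field; exact z0. }
  unfold sphere_grad; rewrite Hg.
  destruct n as [[x y] z]; unfold vsub, vadd, vscal, dot, vx, vy, vz in *; simpl in *.
  apply V3_eq; field; trivial.
Qed.

(** Unlike the normal itself, the field is rational: it is an even function of it. *)
Lemma circles_dirichlet_field (t th : R) :
  is_derive a t (a1 t) -> is_derive b t (b1 t) ->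
  is_derive h t (h1 t) -> is_derive r t (r1 t) -> r t <> 0 -> w t th <> 0 ->
  let D := h1 t ^ 2 + w t th ^ 2 in
  let P := - h1 t * (/ w t th + w t th / D) in
  sphere_grad dirichlet (normal X t th)
  = (P * cos th, P * sin th, w t th ^ 2 / D - D / w t th ^ 2).
Proof.
  intros Ha Hb Hh Hr r0 w0 D P.
  assert (z0 := proj2 (normal_vz t th Ha Hb Hh Hr r0) w0).
  rewrite sphere_grad_dirichlet by trivial.
  assert (D0 : 0 < D) by (unfold D; nra).
  assert (HD : sqrt D * sqrt D = D) by (apply sqrt_sqrt; lra).
  assert (sD0 : 0 < sqrt D) by now apply sqrt_lt_R0.
  assert (sD0' : sqrt D <> 0) by lra.
  assert (Hs : sign (r t) * sign (r t) = 1).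
  { destruct (Rdichotomy _ _ r0); [rewrite sign_eq_m1|rewrite sign_eq_1]; lra. }
  assert (s0 : sign (r t) <> 0) by (intro H; rewrite H in Hs; lra).
  rewrite circles_normal in * by trivial; fold D in z0 |- *; unfold vx, vy, vz in *; cbn [fst snd] in *.
  unfold P; clearbody D.
  set (s := sign (r t)) in *; set (q := sqrt D) in *; set (W := w t th) in *.
  assert (Hq : s / q * (s / q) = / D).
  { rewrite <- HD; transitivity (s * s / (q * q)); [field; trivial|].
    rewrite Hs; field; trivial. }
  assert (Hz : forall x, / (W * (s / q)) * (x * (s / q)) = x / W)
    by (intro; field; repeat split; trivial).
  apply V3_eq.
  - transitivity (/ (W * (s / q)) * (- h1 t * cos th * (s / q))
      + W * (- h1 t * cos th) * (s / q * (s / q))); [ring|].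
    rewrite Hz, Hq; field; split; lra.
  - transitivity (/ (W * (s / q)) * (- h1 t * sin th * (s / q))
      + W * (- h1 t * sin th) * (s / q * (s / q))); [ring|].
    rewrite Hz, Hq; field; split; lra.
  - transitivity (W * W * (s / q * (s / q)) - / (W * W * (s / q * (s / q)))).
    + field; repeat split; trivial.
    + rewrite Hq; field; split; lra.
Qed.

Lemma locally_neq0 (f : R -> R) (x : R) :
  continuous f x -> f x <> 0 -> locally x (fun u => f u <> 0).
Proof.
  intros Hc H0; apply (Hc (fun y => y <> 0)).
  now apply open_neq.
Qed.

(** No square root is ever differentiated. The gradient field along the surface is rational, and in
    the product of the mean curvature with [F (nu)] two odd functions of the normal meet, so its
    normalizing factor enters only squared. *)
Lemma circles_amc (t th : R) :
  jet2 a a1 a2 t -> jet2 b b1 b2 t -> jet2 h h1 h2 t -> jet2 r r1 r2 t ->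
  r t <> 0 -> w t th <> 0 ->
  anisotropic_mean_curvature dirichlet X t th
  = 2 * (r t * (h2 * w t th - h1 t * (a2 * cos th + b2 * sin th + r2))
         + h1 t * (be t th ^ 2 + w t th ^ 2)) / (r t * w t th ^ 3).
Proof.
  intros [La Da] [Lb Db] [Lh Dh] [Lr Dr] r0 w0.
  assert (Ha := locally_singleton _ _ La); assert (Hb := locally_singleton _ _ Lb).
  assert (Hh := locally_singleton _ _ Lh); assert (Hr := locally_singleton _ _ Lr).
  simpl in Ha, Hb, Hh, Hr.
  set (wt := a2 * cos th + b2 * sin th + r2).
  assert (Dw : is_derive (fun u => w u th) t wt).
  { unfold w, wt; auto_derive; [repeat split; eexists; eassumption|].
    rewrite_derive Da; rewrite_derive Db; rewrite_derive Dr; ring. }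
  assert (Dwth : forall v, is_derive (fun v => w t v) v (be t v)).
  { intro v; unfold w, be; auto_derive; trivial; ring. }
  assert (Lw : locally t (fun u => w u th <> 0)).
  { apply (locally_neq0 (fun u => w u th)); trivial.
    apply (ex_derive_continuous (fun u => w u th)); eexists; exact Dw. }
  assert (Lwth : locally th (fun v => w t v <> 0)).
  { apply (locally_neq0 (fun v => w t v)); trivial.
    apply (ex_derive_continuous (fun v => w t v)); eexists; apply Dwth. }
  assert (Lr0 : locally t (fun u => r u <> 0)).
  { apply locally_neq0; trivial.
    apply (ex_derive_continuous r); eexists; exact Hr. }
  set (P := fun u v => - h1 u * (/ w u v + w u v / (h1 u ^ 2 + w u v ^ 2))).
  set (Q := fun u v => w u v ^ 2 / (h1 u ^ 2 + w u v ^ 2)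
                       - (h1 u ^ 2 + w u v ^ 2) / w u v ^ 2).
  assert (D0 : h1 t ^ 2 + w t th ^ 2 <> 0) by nra.
  set (W := w t th) in *; set (H1 := h1 t) in *; set (B := be t th) in *.
  (* [Pt], [Pv], [Qt], [Qv] are the partial derivatives of [P] and [Q] at the point. The last
     fraction in [Qt] and [Qv] comes from writing the subtracted quotient of [Q] as
     [1 + H1 ^ 2 / W ^ 2]. *)
  set (Pt := - h2 * (/ W + W / (H1 ^ 2 + W ^ 2))
    - H1 * (- wt / W ^ 2 + (wt * (H1 ^ 2 + W ^ 2) - W * (2 * H1 * h2 + 2 * W * wt))
                           / (H1 ^ 2 + W ^ 2) ^ 2)).
  set (Pv := - H1 * (- B / W ^ 2 + (B * (H1 ^ 2 + W ^ 2) - W * (2 * W * B))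
                           / (H1 ^ 2 + W ^ 2) ^ 2)).
  set (Qt := (2 * W * wt * (H1 ^ 2 + W ^ 2) - W ^ 2 * (2 * H1 * h2 + 2 * W * wt))
               / (H1 ^ 2 + W ^ 2) ^ 2
             - (2 * H1 * h2 * W ^ 2 - H1 ^ 2 * (2 * W * wt)) / W ^ 4).
  set (Qv := (2 * W * B * (H1 ^ 2 + W ^ 2) - W ^ 2 * (2 * W * B))
               / (H1 ^ 2 + W ^ 2) ^ 2
             + (H1 ^ 2 * (2 * W * B)) / W ^ 4).
  assert (DPt : is_derive (fun u => P u th) t Pt).
  { unfold P; auto_derive; fold W H1.
    - repeat split; trivial; try (eexists; eassumption); simpl in D0; nra.
    - rewrite_derive Dh; rewrite_derive Dw.
      unfold Pt; field; simpl in D0; repeat split; trivial; nra. }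
  assert (DQt : is_derive (fun u => Q u th) t Qt).
  { unfold Q; auto_derive; fold W H1.
    - repeat split; trivial; try (eexists; eassumption); simpl in D0; nra.
    - rewrite_derive Dh; rewrite_derive Dw.
      unfold Qt; field; simpl in D0; repeat split; trivial; nra. }
  assert (DPv : is_derive (fun v => P t v) th Pv).
  { unfold P; auto_derive; fold W H1.
    - repeat split; trivial; try (eexists; apply Dwth); simpl in D0; nra.
    - rewrite_derive (Dwth th).
      unfold Pv; fold B; field; simpl in D0; repeat split; trivial; nra. }
  assert (DQv : is_derive (fun v => Q t v) th Qv).
  { unfold Q; auto_derive; fold W H1.
    - repeat split; trivial; try (eexists; apply Dwth); simpl in D0; nra.
    - rewrite_derive (Dwth th).
      unfold Qv; fold B; field; simpl in D0; repeat split; trivial; nra. }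
  assert (LV : locally t (fun u => sphere_grad dirichlet (normal X u th)
     = (P u th * cos th, P u th * sin th, Q u th))).
  { generalize (filter_and _ _ (filter_and _ _ La Lb) (filter_and _ _ (filter_and _ _ Lh Lr)
      (filter_and _ _ Lw Lr0))).
    apply filter_imp; intros u [[? ?] [[? ?] [? ?]]].
    now apply circles_dirichlet_field. }
  assert (LVth : locally th (fun v => sphere_grad dirichlet (normal X t v)
     = (P t v * cos v, P t v * sin v, Q t v))).
  { generalize Lwth; apply filter_imp; intros v ?.
    now apply circles_dirichlet_field. }
  assert (V1 : Defs.d1 (fun u v => sphere_grad dirichlet (normal X u v)) t th
     = (Pt * cos th, Pt * sin th, Qt)).
  { apply (d1_eq _ (fun u => P u th * cos th) (fun u => P u th * sin th) (fun u => Q u th)); trivial;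
      auto_derive; try (repeat split; eexists; eassumption); rewrite_derive DPt; ring. }
  assert (V2 : Defs.d2 (fun u v => sphere_grad dirichlet (normal X u v)) t th
     = (Pv * cos th - P t th * sin th, Pv * sin th + P t th * cos th, Qv)).
  { apply (d2_eq _ (fun v => P t v * cos v) (fun v => P t v * sin v) (fun v => Q t v)); trivial;
      auto_derive; try (repeat split; eexists; eassumption); rewrite_derive DPv; ring. }
  assert (X11 : Defs.d1 (Defs.d1 X) t th = (a2 + r2 * cos th, b2 + r2 * sin th, h2)).
  { apply (d1_eq _ (fun u => a1 u + r1 u * cos th) (fun u => b1 u + r1 u * sin th) h1); trivial.
    - generalize (filter_and _ _ (filter_and _ _ La Lb) (filter_and _ _ Lh Lr)).
      apply filter_imp; intros u [[? ?] [? ?]]; now apply circles_d1.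
    - auto_derive; try (repeat split; eexists; eassumption);
        rewrite_derive Da; rewrite_derive Dr; ring.
    - auto_derive; try (repeat split; eexists; eassumption);
        rewrite_derive Db; rewrite_derive Dr; ring. }
  assert (X21 : Defs.d2 (Defs.d1 X) t th = (- r1 t * sin th, r1 t * cos th, 0)).
  { apply (d2_eq _ (fun v => a1 t + r1 t * cos v) (fun v => b1 t + r1 t * sin v) (fun v => h1 t));
      [apply filter_forall; intro v; now apply circles_d1|auto_derive; trivial; ring..]. }
  assert (X22 : Defs.d2 (Defs.d2 X) t th = (- r t * cos th, - r t * sin th, 0)).
  { apply (d2_eq _ (fun v => - r t * sin v) (fun v => r t * cos v) (fun v => 0));
      [apply filter_forall; intro v; now apply circles_d2|auto_derive; trivial; ring..]. }
  (* In the orthonormal frame [(cos, sin, 0)], [(- sin, cos, 0)], [(0, 0, 1)] the vectors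
     [X_t], [X_th] have components [(W, B, H1)], [(0, r, 0)], which makes every
     quantity rational in [W], [B], [H1], [r] and their derivatives. *)
  assert (CS := cos2_sin2 th).
  assert (HW : W = a1 t * cos th + b1 t * sin th + r1 t) by reflexivity.
  assert (HB : B = b1 t * cos th - a1 t * sin th) by reflexivity.
  set (C := cos th) in *; set (S := sin th) in *.
  assert (Ea : a1 t + r1 t * C = W * C - B * S).
  { rewrite HW, HB.
    transitivity (a1 t * (C * C + S * S) + r1 t * C); [rewrite CS|]; ring. }
  assert (Eb : b1 t + r1 t * S = W * S + B * C).
  { rewrite HW, HB.
    transitivity (b1 t * (C * C + S * S) + r1 t * S); [rewrite CS|]; ring. }
  assert (Ext : forall p q p' q' : R,
     (p * C - q * S) * (p' * C - q' * S) + (p * S + q * C) * (p' * S + q' * C)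
     = p * p' + q * q').
  { intros; transitivity ((p * p' + q * q') * (C * C + S * S)); [ring|rewrite CS; ring]. }
  assert (G11 : g11 X t th = W ^ 2 + B ^ 2 + H1 ^ 2).
  { unfold g11; rewrite circles_d1 by trivial; fold C S.
    rewrite Ea, Eb; unfold dot, vx, vy, vz; simpl; rewrite Ext; unfold H1; ring. }
  assert (G12 : g12 X t th = r t * B).
  { unfold g12; rewrite circles_d1, circles_d2 by trivial; fold C S.
    rewrite Ea, Eb; unfold dot, vx, vy, vz; simpl.
    transitivity (r t * B * (C * C + S * S)); [ring|rewrite CS; ring]. }
  assert (G22 : g22 X t th = r t ^ 2).
  { unfold g22; rewrite circles_d2 by trivial; fold C S.
    unfold dot, vx, vy, vz; simpl.
    transitivity (r t ^ 2 * (C * C + S * S)); [ring|rewrite CS; ring]. }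
  assert (GD : detg X t th = r t ^ 2 * (H1 ^ 2 + W ^ 2)).
  { unfold detg; rewrite G11, G12, G22; ring. }
  assert (Hdiv : surface_div X (fun u v => sphere_grad dirichlet (normal X u v)) t th
    = (r t ^ 2 * (Pt * W + Qt * H1) - r t * B * (Pv * W + P t th * B + Qv * H1)
       + (W ^ 2 + B ^ 2 + H1 ^ 2) * (P t th * r t)) / (r t ^ 2 * (H1 ^ 2 + W ^ 2))).
  { unfold surface_div; rewrite GD, G11, G12, G22, V1, V2, circles_d1, circles_d2 by trivial.
    fold C S H1; rewrite Ea, Eb; unfold dot, vx, vy, vz; simpl.
    f_equal; f_equal; [f_equal|].
    - f_equal; transitivity (Pt * W * (C * C + S * S) + Qt * H1); [ring|rewrite CS; ring].
    - f_equal. rewrite Ext.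
      transitivity (Pt * r t * 0 + (Pv * W + P t th * B + Qv * H1)); ring.
    - f_equal; transitivity (P t th * r t * (C * C + S * S)); [ring|rewrite CS; ring]. }
  set (q := sign (r t) / sqrt (H1 ^ 2 + W ^ 2)).
  assert (Hq2 : q * q = / (H1 ^ 2 + W ^ 2)).
  { assert (Dp : 0 < H1 ^ 2 + W ^ 2) by nra.
    assert (HD : sqrt (H1 ^ 2 + W ^ 2) * sqrt (H1 ^ 2 + W ^ 2) = H1 ^ 2 + W ^ 2)
      by (apply sqrt_sqrt; lra).
    assert (sD0 := sqrt_lt_R0 _ Dp).
    assert (Hs : sign (r t) * sign (r t) = 1).
    { destruct (Rdichotomy _ _ r0); [rewrite sign_eq_m1|rewrite sign_eq_1]; lra. }
    rewrite <- HD at 1; unfold q.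
    transitivity (sign (r t) * sign (r t) / (sqrt (H1 ^ 2 + W ^ 2) * sqrt (H1 ^ 2 + W ^ 2)));
      [field; lra|rewrite Hs, ?HD; field; trivial]. }
  assert (q0 : q <> 0) by (intro E; rewrite E in Hq2; apply Rinv_neq_0_compat in D0; lra).
  assert (HN : normal X t th = (- H1 * C * q, - H1 * S * q, W * q)).
  { rewrite circles_normal by trivial; reflexivity. }
  assert (HH : mean_curvature X t th * dirichlet (normal X t th)
    = (r t ^ 2 * (h2 * W - H1 * wt) + (W ^ 2 + B ^ 2 + H1 ^ 2) * (r t * H1))
      / (2 * (r t ^ 2 * (H1 ^ 2 + W ^ 2))) * (/ W - W / (H1 ^ 2 + W ^ 2))).
  { unfold mean_curvature, dirichlet; rewrite GD, G11, G12, G22, X11, X21, X22, HN.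
    fold C S; unfold dot, vx, vy, vz; simpl fst; simpl snd.
    (* [C * C + S * S] and [q * q] stay unevaluated here, so that the first step is an identity of
       rational functions; their values enter only in the second. *)
    transitivity (
      (r t ^ 2 * (h2 * W - H1 * (a2 * C + b2 * S + r2 * (C * C + S * S)))
       + (W ^ 2 + B ^ 2 + H1 ^ 2) * (r t * H1 * (C * C + S * S)))
      / (2 * (r t ^ 2 * (H1 ^ 2 + W ^ 2))) * (/ W - W * (q * q))).
    - field; repeat split; trivial.
    - rewrite CS, Hq2; unfold wt, Rdiv; fold C S.
      f_equal; f_equal; ring. }
  unfold anisotropic_mean_curvature.
  rewrite Rmult_assoc, HH, Hdiv.
  unfold P; fold W H1; unfold Pt, Pv, Qt, Qv; clearbody wt W H1 B.
  field; repeat split; trivial.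
Qed.

End Curvature.

(** * Functions on open intervals *)

Lemma itv_locally lo hi t : in_itv lo hi t -> locally t (in_itv lo hi).
Proof.
  intros [H1 H2]; apply filter_and.
  - now apply (open_Rbar_gt lo).
  - now apply (open_Rbar_lt hi).
Qed.

Lemma itv_between lo hi x y z :
  in_itv lo hi x -> in_itv lo hi y -> x <= z <= y -> in_itv lo hi z.
Proof.
  intros [H1 _] [_ H2] Hz; split.
  - now apply Rbar_lt_le_trans with x.
  - now apply Rbar_le_lt_trans with y.
Qed.

Lemma itv_inhabited lo hi : Rbar_lt lo hi -> exists t, in_itv lo hi t.
Proof.
  intro H; destruct lo as [lo| |], hi as [hi| |]; simpl in H; try easy.
  - exists ((lo + hi) / 2); split; simpl; lra.
  - exists (lo + 1); split; simpl; trivial; lra.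
  - exists (hi - 1); split; simpl; trivial; lra.
  - exists 0; split; simpl; trivial.
Qed.

Lemma itv_constant lo hi (f : R -> R) :
  (forall t, in_itv lo hi t -> is_derive f t 0) ->
  forall x y, in_itv lo hi x -> in_itv lo hi y -> f x = f y.
Proof.
  intros Hf.
  assert (Hlt : forall x y, in_itv lo hi x -> in_itv lo hi y -> x < y -> f x = f y).
  { intros x y Hx Hy Hxy; apply eq_is_derive; trivial.
    intros t Ht; apply Hf; now apply itv_between with x y. }
  intros x y Hx Hy; destruct (Rtotal_order x y) as [H|[->|H]]; auto.
  symmetry; auto.
Qed.

Lemma smooth_jet2 lo hi f t :
  smooth_on lo hi f -> in_itv lo hi t ->
  jet2 f (Derive f) (Derive (Derive f) t) t.
Proof.
  intros Hf Ht; split.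
  - generalize (itv_locally _ _ _ Ht); apply filter_imp; intros u Hu.
    apply Derive_correct; exact (Hf u Hu 1%nat).
  - apply Derive_correct; exact (Hf t Ht 2%nat).
Qed.

(** A difference quotient closer to [l] than [Rabs l] has the sign of [l], so the values taken on
    the two sides of [t] lie on opposite sides of [f t]. This makes images open. *)
Lemma derive_neq0_both_sides lo hi (f : R -> R) (l t : R) :
  in_itv lo hi t -> is_derive f t l -> l <> 0 ->
  exists u v, in_itv lo hi u /\ in_itv lo hi v /\ f u < f t < f v.
Proof.
  intros Ht Hf l0.
  destruct (itv_locally _ _ _ Ht) as [e He].
  apply is_derive_Reals in Hf.
  destruct (Hf (Rabs l)) as [d Hd]; [now apply Rabs_pos_lt|].
  set (x := Rmin e d / 2).
  assert (Hx : 0 < x /\ x < e /\ x < d).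
  { assert (0 < Rmin e d) by (apply Rmin_case; apply cond_pos).
    generalize (Rmin_l e d) (Rmin_r e d); unfold x; lra. }
  assert (Hi : forall y, Rabs y = x -> in_itv lo hi (t + y)).
  { intros y Hy; apply He; unfold ball; simpl; unfold AbsRing_ball, abs, minus, plus, opp; simpl.
    replace (t + y + - t) with y by ring; lra. }
  assert (Hs : forall y, y <> 0 -> Rabs y = x -> 0 < (f (t + y) - f t) * (y * l)).
  { intros y y0 Hy; specialize (Hd y y0 ltac:(lra)).
    set (q := (f (t + y) - f t) / y) in *.
    assert (E : f (t + y) - f t = q * y) by (unfold q; field; trivial).
    rewrite E; assert (0 < q * l).
    { revert Hd; unfold Rabs; destruct (Rcase_abs (q - l)), (Rcase_abs l); nra. }
    replace (q * y * (y * l)) with (q * l * (y * y)) by ring.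
    apply Rmult_lt_0_compat; [trivial|now apply Rsqr_pos_lt]. }
  assert (Hp : Rabs x = x) by (apply Rabs_pos_eq; lra).
  assert (Hm : Rabs (- x) = x) by (now rewrite Rabs_Ropp).
  assert (P1 := Hs x ltac:(lra) Hp); assert (P2 := Hs (- x) ltac:(lra) Hm).
  assert (Hpos : forall A B, 0 < A * B -> 0 < B -> 0 < A) by (clear; intros; nra).
  assert (Hneg : forall A B, 0 < A * B -> B < 0 -> A < 0) by (clear; intros; nra).
  destruct (Rdichotomy _ _ l0) as [l1|l1].
  - exists (t + x), (t + - x); repeat split; try (now apply Hi).
    + assert (x * l < 0) by nra; specialize (Hneg _ _ P1); lra.
    + assert (0 < - x * l) by nra; specialize (Hpos _ _ P2); lra.
  - exists (t + - x), (t + x); repeat split; try (now apply Hi).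
    + assert (- x * l < 0) by nra; specialize (Hneg _ _ P2); lra.
    + assert (0 < x * l) by nra; specialize (Hpos _ _ P1); lra.
Qed.

Lemma itv_ivt lo hi (f : R -> R) u v s :
  (forall t, in_itv lo hi t -> continuity_pt f t) ->
  in_itv lo hi u -> in_itv lo hi v -> f u < s < f v ->
  exists t, in_itv lo hi t /\ f t = s.
Proof.
  intros Hf Hu Hv Hs.
  destruct (Rtotal_order u v) as [H|[->|H]]; [|lra|].
  - destruct (f_interv_is_interv f u v s H ltac:(lra)) as [t [Ht E]].
    + intros x Hx; apply Hf; now apply itv_between with u v.
    + exists t; split; trivial; now apply itv_between with u v.
  - destruct (f_interv_is_interv (fun x => - f x) v u (- s) H ltac:(lra)) as [t [Ht E]].
    + intros x Hx; apply continuity_pt_opp, Hf; now apply itv_between with v u.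
    + exists t; split; [now apply itv_between with v u|lra].
Qed.

(** The heights swept out by the foliation become the parameter interval of a model. The image is
    convex by the intermediate value theorem and has no extremal value, so it consists of the points
    strictly between its infimum and its supremum, finite or not. *)
Lemma itv_image lo hi (f f1 : R -> R) :
  Rbar_lt lo hi ->
  (forall t, in_itv lo hi t -> is_derive f t (f1 t)) ->
  (forall t, in_itv lo hi t -> f1 t <> 0) ->
  exists jlo jhi, Rbar_lt jlo jhi /\
    forall s, in_itv jlo jhi s <-> exists t, in_itv lo hi t /\ f t = s.
Proof.
  intros Hlt Hd H0.
  set (S := fun s : R => exists t, in_itv lo hi t /\ f t = s).
  assert (Hsides : forall s, S s -> exists u v, S u /\ S v /\ u < s < v).
  { intros s (t & Ht & <-).
    destruct (derive_neq0_both_sides lo hi f (f1 t) t) as (u & v & Hu & Hv & Huv); auto.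
    exists (f u), (f v); split; [now exists u|split; [now exists v|trivial]]. }
  destruct (Lub_Rbar_correct S) as [ub lub]; destruct (Glb_Rbar_correct S) as [lb glb].
  assert (HJ : forall s, in_itv (Glb_Rbar S) (Lub_Rbar S) s <-> S s).
  { intro s; split.
    - intros [Hl Hh].
      assert (HE : ~ forall v, S v -> v <= s).
      { intro H; apply (Rbar_lt_not_le _ _ Hh), lub; intros v Hv; now apply H. }
      assert (HE' : ~ forall u, S u -> s <= u).
      { intro H; apply (Rbar_lt_not_le _ _ Hl), glb; intros u Hu; now apply H. }
      apply not_all_ex_not in HE; destruct HE as [v Hv].
      apply not_all_ex_not in HE'; destruct HE' as [u Hu].
      apply imply_to_and in Hv; apply Classical_Prop.imply_to_and in Hu.
      destruct Hv as [(tv & Htv & <-) Hv], Hu as [(tu & Htu & <-) Hu].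
      apply itv_ivt with tu tv; trivial; [|lra].
      intros t Ht; apply derivable_continuous_pt; exists (f1 t).
      now apply is_derive_Reals, Hd.
    - intro Hs; destruct (Hsides s Hs) as (u & v & Hu & Hv & Huv); split.
      + apply Rbar_le_lt_trans with u; [now apply lb|simpl; lra].
      + apply Rbar_lt_le_trans with v; [simpl; lra|now apply ub]. }
  exists (Glb_Rbar S), (Lub_Rbar S); split; [|exact HJ].
  destruct (itv_inhabited lo hi Hlt) as [t Ht].
  assert (Hs : S (f t)) by (exists t; auto).
  apply HJ in Hs; destruct Hs; now apply Rbar_lt_trans with (f t).
Qed.

Lemma angle_exists (x y : R) :
  x ^ 2 + y ^ 2 = 1 -> exists th, cos th = x /\ sin th = y.
Proof.
  intro H.
  assert (Hx : -1 <= x <= 1) by nra.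
  assert (Hc : cos (acos x) = x) by (apply cos_acos; lra).
  assert (Hs := sin2_cos2 (acos x)); rewrite Hc in Hs; unfold Rsqr in Hs.
  assert (Hy : (sin (acos x) - y) * (sin (acos x) + y) = 0) by nra.
  apply Rmult_integral in Hy; destruct Hy as [Hy|Hy].
  - exists (acos x); split; lra.
  - exists (- acos x); rewrite cos_neg, sin_neg; split; lra.
Qed.

(** * The three families *)

(** The inverse radius (up to sign) and its derivative: in all three cases
    [rho'' = E rho] and [rho'^2 - E rho^2 = k^2], and the centers are
    [- (lam, mu) rho' / (k^2 rho)], so that the types can be treated uniformly. *)
Definition fam_rho (T : solution_type) (c k s : R) : R :=
  match T with
  | TypeI => k * cos (c * s) / c
  | TypeII => k * s + c
  | TypeIII => k * sinh (c * s) / c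
  end.

Definition fam_sigma (T : solution_type) (c k s : R) : R :=
  match T with
  | TypeI => - k * sin (c * s)
  | TypeII => k
  | TypeIII => k * cosh (c * s)
  end.

Definition fam_E (T : solution_type) (c : R) : R :=
  match T with TypeI => - c ^ 2 | TypeII => 0 | TypeIII => c ^ 2 end.

Lemma cosh2_sinh2 (x : R) : cosh x ^ 2 - sinh x ^ 2 = 1.
Proof.
  unfold cosh, sinh; transitivity (exp x * exp (- x)); [field|].
  rewrite <- exp_plus, Rplus_opp_r; apply exp_0.
Qed.

Lemma fam_rho_derive T c k s :
  c <> 0 -> is_derive (fam_rho T c k) s (fam_sigma T c k s).
Proof.
  intro c0; destruct T; unfold fam_rho, fam_sigma; auto_derive; trivial.
  - field; trivial.
  - ring.
  - field; trivial.
Qed.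

Lemma fam_sigma_derive T c k s :
  c <> 0 -> is_derive (fam_sigma T c k) s (fam_E T c * fam_rho T c k s).
Proof.
  intro c0; destruct T; unfold fam_rho, fam_sigma, fam_E; auto_derive; trivial.
  - field; trivial.
  - ring.
  - field; trivial.
Qed.

Lemma fam_conserved T c k s :
  c <> 0 -> fam_sigma T c k s ^ 2 - fam_E T c * fam_rho T c k s ^ 2 = k ^ 2.
Proof.
  intro c0; destruct T; unfold fam_rho, fam_sigma, fam_E.
  - transitivity (k ^ 2 * (cos (c * s) * cos (c * s) + sin (c * s) * sin (c * s)));
      [field; trivial|rewrite cos2_sin2; ring].
  - ring.
  - transitivity (k ^ 2 * (cosh (c * s) ^ 2 - sinh (c * s) ^ 2));
      [field; trivial|rewrite cosh2_sinh2; ring].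
Qed.

Section Family.
Variables (T : solution_type) (c lam mu : R).
Hypotheses (c0 : c <> 0) (k0 : lam ^ 2 + mu ^ 2 <> 0).
Let k := sqrt (lam ^ 2 + mu ^ 2).
Let rho := fam_rho T c k.
Let sg := fam_sigma T c k.

Lemma family_k_sqr : k * k = lam ^ 2 + mu ^ 2.
Proof. apply sqrt_sqrt; nra. Qed.

Lemma family_k_neq0 : k <> 0.
Proof. intro H; apply k0; rewrite <- family_k_sqr, H; ring. Qed.

Lemma in_domain_rho s : in_domain T c lam mu s <-> rho s <> 0.
Proof.
  assert (Hk := family_k_neq0); unfold rho, fam_rho, in_domain; fold k.
  destruct T; try tauto; (split; intros H H'; apply H).
  - apply Rmult_integral in H'; destruct H' as [H'|H'].
    + now apply Rmult_integral in H'; destruct H'.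
    + now apply Rinv_neq_0_compat in H'.
  - rewrite H'; unfold Rdiv; ring.
  - apply Rmult_integral in H'; destruct H' as [H'|H'].
    + now apply Rmult_integral in H'; destruct H'.
    + now apply Rinv_neq_0_compat in H'.
  - rewrite H'; unfold Rdiv; ring.
Qed.

Lemma radius_rho s : in_domain T c lam mu s -> radius T c lam mu s = / rho s.
Proof.
  assert (Hk := family_k_neq0); unfold rho, fam_rho, in_domain, radius; fold k.
  destruct T; intro H; field; repeat split; trivial.
Qed.

Lemma center_x_rho s :
  in_domain T c lam mu s -> center_x T c lam mu s = - (lam * sg s / (k ^ 2 * rho s)).
Proof.
  assert (Hk := family_k_neq0); assert (Hk2 := family_k_sqr).
  unfold rho, sg, fam_rho, fam_sigma, in_domain, center_x; fold k.
  rewrite <- Hk2.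
  destruct T; intro H.
  - unfold tan; field; repeat split; trivial.
  - assert (k * k * s + c * k <> 0); [|now field].
    replace (k * k * s + c * k) with (k * (k * s + c)) by ring.
    now apply Rmult_integral_contrapositive_currified.
  - unfold coth; field; repeat split; trivial.
Qed.

Lemma center_y_rho s :
  in_domain T c lam mu s -> center_y T c lam mu s = - (mu * sg s / (k ^ 2 * rho s)).
Proof.
  assert (Hk := family_k_neq0); assert (Hk2 := family_k_sqr).
  unfold rho, sg, fam_rho, fam_sigma, in_domain, center_y; fold k.
  rewrite <- Hk2.
  destruct T; intro H.
  - unfold tan; field; repeat split; trivial.
  - assert (k * k * s + c * k <> 0); [|now field].
    replace (k * k * s + c * k) with (k * (k * s + c)) by ring.
    now apply Rmult_integral_contrapositive_currified.
  - unfold coth; field; repeat split; trivial.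
Qed.

Lemma in_domain_locally s :
  in_domain T c lam mu s -> locally s (in_domain T c lam mu).
Proof.
  intro H; apply filter_imp with (fun u => rho u <> 0).
  - intros u Hu; now apply in_domain_rho.
  - apply locally_neq0; [|now apply in_domain_rho].
    apply (ex_derive_continuous rho); eexists; now apply fam_rho_derive.
Qed.

Lemma radius_derive s :
  in_domain T c lam mu s -> is_derive (radius T c lam mu) s (- sg s / rho s ^ 2).
Proof.
  intro H; apply is_derive_ext_loc with (fun u => / rho u).
  - generalize (in_domain_locally s H); apply filter_imp; intros u Hu.
    now rewrite radius_rho.
  - apply in_domain_rho in H.
    assert (D := fam_rho_derive T c k s c0); fold rho sg in D.
    auto_derive; [repeat split; try (eexists; eassumption); trivial|].
    rewrite_derive D; field; trivial.
Qed.

(** The conservation law gives [(sg / rho)' = - k ^ 2 / rho ^ 2]; hence the centers move with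
    horizontal velocity [(lam, mu)] times the squared radius, as the first integrals demand. *)
Lemma is_derive_sg_rho (l s : R) :
  rho s <> 0 -> is_derive (fun u => - (l * sg u / (k ^ 2 * rho u))) s (l / rho s ^ 2).
Proof.
  intro H; assert (Hk := family_k_neq0).
  assert (D := fam_rho_derive T c k s c0); fold rho sg in D.
  assert (D' := fam_sigma_derive T c k s c0); fold rho sg in D'.
  assert (C := fam_conserved T c k s c0); fold rho sg in C.
  auto_derive.
  - repeat split; try (eexists; eassumption).
    change (k * (k * 1) * rho s <> 0).
    apply Rmult_integral_contrapositive_currified; trivial.
    intro E; apply Hk; nra.
  - rewrite_derive D; rewrite_derive D'.
    transitivity (l / rho s ^ 2 * ((sg s ^ 2 - fam_E T c * rho s ^ 2) / k ^ 2));
      [field; split; trivial|rewrite C; field; split; trivial].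
Qed.

Lemma center_x_derive s :
  in_domain T c lam mu s -> is_derive (center_x T c lam mu) s (lam / rho s ^ 2).
Proof.
  intro H; apply is_derive_ext_loc with (fun u => - (lam * sg u / (k ^ 2 * rho u))).
  - generalize (in_domain_locally s H); apply filter_imp; intros u Hu.
    now rewrite center_x_rho.
  - apply is_derive_sg_rho; now apply in_domain_rho.
Qed.

Lemma center_y_derive s :
  in_domain T c lam mu s -> is_derive (center_y T c lam mu) s (mu / rho s ^ 2).
Proof.
  intro H; apply is_derive_ext_loc with (fun u => - (mu * sg u / (k ^ 2 * rho u))).
  - generalize (in_domain_locally s H); apply filter_imp; intros u Hu.
    now rewrite center_y_rho.
  - apply is_derive_sg_rho; now apply in_domain_rho.
Qed.

Lemma radius_jet2 s :
  in_domain T c lam mu s ->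
  jet2 (radius T c lam mu) (fun u => - sg u / rho u ^ 2)
    (2 * sg s ^ 2 / rho s ^ 3 - fam_E T c / rho s) s.
Proof.
  intro H; split.
  - generalize (in_domain_locally s H); apply filter_imp; intros u; apply radius_derive.
  - apply in_domain_rho in H.
    assert (D := fam_rho_derive T c k s c0); fold rho sg in D.
    assert (D' := fam_sigma_derive T c k s c0); fold rho sg in D'.
    auto_derive; [repeat split; try (eexists; eassumption); nra|].
    rewrite_derive D; rewrite_derive D'; field; trivial.
Qed.

Lemma inv_rho2_derive (l s : R) :
  in_domain T c lam mu s ->
  is_derive (fun u => l / rho u ^ 2) s (- 2 * l * sg s / rho s ^ 3).
Proof.
  intro H; apply in_domain_rho in H.
  assert (D := fam_rho_derive T c k s c0); fold rho sg in D.
  auto_derive; [repeat split; try (eexists; eassumption); nra|].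
  rewrite_derive D; field; trivial.
Qed.

Lemma center_x_jet2 s :
  in_domain T c lam mu s ->
  jet2 (center_x T c lam mu) (fun u => lam / rho u ^ 2) (- 2 * lam * sg s / rho s ^ 3) s.
Proof.
  intro H; split; [|now apply inv_rho2_derive].
  generalize (in_domain_locally s H); apply filter_imp; intros u; apply center_x_derive.
Qed.

Lemma center_y_jet2 s :
  in_domain T c lam mu s ->
  jet2 (center_y T c lam mu) (fun u => mu / rho u ^ 2) (- 2 * mu * sg s / rho s ^ 3) s.
Proof.
  intro H; split; [|now apply inv_rho2_derive].
  generalize (in_domain_locally s H); apply filter_imp; intros u; apply center_y_derive.
Qed.

End Family.

(** * Geometry of the families *)

(** Zeros at [th], [th + d] and [th - d] for a single small [d] already annihilate a trigonometric
    polynomial of degree 1: with the value at [th], the sum and the difference of the outer values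
    kill [A * cos th + B * sin th] and its derivative. *)
Lemma trig_dense_neq0 (A B C th eps : R) :
  A ^ 2 + B ^ 2 <> 0 -> 0 < eps ->
  exists th', Rabs (th' - th) < eps /\ A * cos th' + B * sin th' + C <> 0.
Proof.
  intros HAB He; apply NNPP; intro Hno.
  assert (Hz : forall x, Rabs x < eps -> A * cos (th + x) + B * sin (th + x) + C = 0).
  { intros x Hx; apply NNPP; intro H; apply Hno; exists (th + x); split; trivial.
    replace (th + x - th) with x by ring; trivial. }
  set (d := Rmin (eps / 2) 1).
  assert (Hd : 0 < d /\ d < eps /\ d <= 1).
  { unfold d; generalize (Rmin_l (eps / 2) 1) (Rmin_r (eps / 2) 1).
    assert (0 < Rmin (eps / 2) 1) by (apply Rmin_case; lra); lra. }
  assert (Hpi := PI2_1).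
  assert (Hs : 0 < sin d) by (apply sin_gt_0; lra).
  assert (Hc : cos d < 1) by (rewrite <- cos_0; apply cos_decreasing_1; lra).
  assert (E0 := Hz 0 ltac:(rewrite Rabs_R0; lra)).
  assert (E1 := Hz d ltac:(rewrite Rabs_pos_eq; lra)).
  assert (E2 := Hz (- d) ltac:(rewrite Rabs_Ropp, Rabs_pos_eq; lra)).
  rewrite Rplus_0_r in E0; rewrite !cos_plus, !sin_plus, ?cos_neg, ?sin_neg in *.
  assert (CS := cos2_sin2 th).
  set (x := cos th) in *; set (y := sin th) in *.
  set (p := cos d) in *; set (q := sin d) in *.
  assert (F1 : A * x + B * y = 0).
  { apply (Rmult_eq_reg_l (p - 1)); [nra|lra]. }
  assert (F2 : B * x - A * y = 0).
  { apply (Rmult_eq_reg_l q); [nra|lra]. }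
  apply HAB; transitivity ((A ^ 2 + B ^ 2) * (x * x + y * y)); [rewrite CS; ring|].
  transitivity ((A * x + B * y) ^ 2 + (B * x - A * y) ^ 2); [ring|].
  rewrite F1, F2; ring.
Qed.

(** * Angles modulo [2 * PI] *)

Lemma angle_reduction (x : R) : exists k : Z, - PI <= x + 2 * IZR k * PI <= PI.
Proof.
  assert (Hpi := PI_RGT_0).
  set (y := (x + PI) / (2 * PI)).
  exists (- Int_part y)%Z; destruct (base_Int_part y) as [H1 H2].
  rewrite opp_IZR; assert (E : x = 2 * PI * y - PI) by (unfold y; field; lra).
  rewrite E; split; nra.
Qed.

Lemma cos_periodZ (x : R) (k : Z) : cos (x + 2 * IZR k * PI) = cos x.
Proof.
  destruct (Z_le_gt_dec 0 k) as [H|H].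
  - rewrite <- (Z2Nat.id k H), <- INR_IZR_INZ; apply cos_period.
  - replace (cos x) with (cos ((x + 2 * IZR k * PI) + 2 * INR (Z.to_nat (- k)) * PI)).
    + symmetry; apply cos_period.
    + f_equal; rewrite INR_IZR_INZ, Z2Nat.id, opp_IZR by lia; ring.
Qed.

Lemma cos_Rabs (x : R) : cos (Rabs x) = cos x.
Proof. unfold Rabs; destruct (Rcase_abs x); trivial; apply cos_neg. Qed.

Lemma cos_near_max (x e : R) :
  0 < e <= PI -> cos e < cos x -> exists k : Z, Rabs (x + 2 * IZR k * PI) < e.
Proof.
  intros He Hx; destruct (angle_reduction x) as [k Hk]; exists k.
  rewrite <- (cos_periodZ x k), <- (cos_Rabs (x + _)) in Hx.
  set (y := x + 2 * IZR k * PI) in *.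
  apply Rnot_le_lt; intro H.
  assert (Rabs y <= PI) by (apply Rabs_le; lra).
  assert (cos (Rabs y) <= cos e).
  { destruct H as [H|H]; [apply Rlt_le, cos_decreasing_1|rewrite H]; lra. }
  lra.
Qed.

Lemma cos_sin_inj (x y : R) :
  cos x = cos y -> sin x = sin y -> exists k : Z, y = x + 2 * IZR k * PI.
Proof.
  intros Hc Hs; assert (Hpi := PI_RGT_0).
  assert (H1 : cos (y - x) = 1).
  { rewrite cos_minus, Hc, Hs; apply cos2_sin2. }
  destruct (angle_reduction (y - x)) as [k Hk]; exists (- k)%Z.
  rewrite <- (cos_periodZ _ k), <- cos_Rabs in H1.
  set (z := y - x + 2 * IZR k * PI) in *.
  assert (Rabs z <= PI) by (apply Rabs_le; lra).
  assert (z0 : z = 0).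
  { apply NNPP; intro z0; apply Rabs_pos_lt in z0.
    assert (cos (Rabs z) < cos 0) by (apply cos_decreasing_1; lra).
    rewrite cos_0 in *; lra. }
  rewrite opp_IZR; unfold z in z0; lra.
Qed.

(** * Circles parametrized by height: injectivity and continuity of the inverse *)

Lemma Rabs_le_vnorm (p : V3) :
  Rabs (vx p) <= vnorm p /\ Rabs (vy p) <= vnorm p /\ Rabs (vz p) <= vnorm p.
Proof.
  unfold vnorm, dot; rewrite <- !sqrt_Rsqr_abs; unfold Rsqr.
  repeat split; apply sqrt_le_1_alt; nra.
Qed.

(** The third coordinate is the parameter, so circles with different parameters are disjoint and
    only angles on a single circle remain to be compared. *)
Lemma circles_injective (a b r : R -> R) (s th s' th' : R) :
  r s <> 0 ->
  circles a b (fun t => t) r s th = circles a b (fun t => t) r s' th' ->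
  s = s' /\ exists k : Z, th' = th + 2 * IZR k * PI.
Proof.
  unfold circles, vadd, vscal, vx, vy, vz; cbn [fst snd]; intros r0 E.
  injection E as Ex Ey Ez.
  assert (s = s') as <- by lra; split; trivial.
  apply cos_sin_inj; apply (Rmult_eq_reg_l (r s)); lra.
Qed.

Lemma circles_inverse_continuous (a b r : R -> R) (s th eps : R) :
  continuous a s -> continuous b s -> continuous r s -> r s <> 0 -> 0 < eps ->
  exists delta, 0 < delta /\
    forall s' th',
      vnorm (vsub (circles a b (fun t => t) r s' th') (circles a b (fun t => t) r s th)) < delta ->
      Rabs (s' - s) < eps /\ exists k : Z, Rabs (th' + 2 * IZR k * PI - th) < eps.
Proof.
  intros Ca Cb Cr r0 He; assert (Hpi := PI2_1).
  set (e := Rmin eps 1).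
  assert (Hee : 0 < e <= 1 /\ e <= eps).
  { unfold e; generalize (Rmin_l eps 1) (Rmin_r eps 1).
    assert (0 < Rmin eps 1) by (apply Rmin_case; lra); lra. }
  assert (Hce : cos e < 1) by (rewrite <- cos_0; apply cos_decreasing_1; lra).
  assert (Hr : 0 < Rabs (r s)) by now apply Rabs_pos_lt.
  (* Origin of the 6: three errors of at most [eta] (point, center, radius) bound [Rabs (r s)] times
     the variation of [cos] or [sin], and that variation must be at most [(1 - cos e) / 2]. *)
  set (eta := Rabs (r s) * (1 - cos e) / 6).
  assert (Heta : 0 < eta) by (unfold eta; apply Rdiv_lt_0_compat; [apply Rmult_lt_0_compat|]; lra).
  assert (Hloc : forall f, continuous f s -> exists d : posreal,
     forall u, Rabs (u - s) < d -> Rabs (f u - f s) < eta).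
  { intros f Hf; destruct (proj1 (filterlim_locally _ _) Hf (mkposreal _ Heta)) as [d Hd].
    exists d; intros u Hu; exact (Hd u Hu). }
  destruct (Hloc a Ca) as [da Ha], (Hloc b Cb) as [db Hb], (Hloc r Cr) as [dr Hdr].
  exists (Rmin (Rmin eta eps) (Rmin da (Rmin db dr))).
  split.
  { repeat apply Rmin_case; trivial; apply cond_pos. }
  intros s' th' H.
  destruct (Rabs_le_vnorm (vsub (circles a b (fun t => t) r s' th') (circles a b (fun t => t) r s th)))
    as (Hx & Hy & Hz).
  revert Hx Hy Hz H; generalize (vnorm (vsub (circles a b (fun t => t) r s' th')
    (circles a b (fun t => t) r s th))); intros n Hx Hy Hz H.
  assert (Hn : n < eta /\ n < eps /\ n < da /\ n < db /\ n < dr).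
  { revert H; generalize (Rmin_l (Rmin eta eps) (Rmin da (Rmin db dr)))
      (Rmin_r (Rmin eta eps) (Rmin da (Rmin db dr))) (Rmin_l eta eps) (Rmin_r eta eps)
      (Rmin_l da (Rmin db dr)) (Rmin_r da (Rmin db dr)) (Rmin_l db dr) (Rmin_r db dr).
    intros; repeat split; lra. }
  unfold vsub, circles, vadd, vscal, vx, vy, vz in Hx, Hy, Hz; cbn [fst snd] in Hx, Hy, Hz.
  assert (Hs : Rabs (s' - s) <= n).
  { replace (s' - s) with (s' + r s' * 0 + -1 * (s + r s * 0)) by ring; trivial. }
  split; [lra|].
  specialize (Ha s' ltac:(lra)); specialize (Hb s' ltac:(lra)); specialize (Hdr s' ltac:(lra)).
  assert (Hmul : forall A A' B x y, Rabs x <= 1 ->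
     Rabs (A' + r s' * x + -1 * (A + r s * y)) <= n -> Rabs (A' - A) < eta -> B = x - y ->
     Rabs (r s) * Rabs B <= 3 * eta).
  { intros A A' B x y Hx1 H1 H2 ->; rewrite <- Rabs_mult.
    replace (r s * (x - y)) with ((A' + r s' * x + -1 * (A + r s * y))
      - ((A' - A) + (r s' - r s) * x)) by ring.
    assert (Rabs ((r s' - r s) * x) <= eta * 1).
    { rewrite Rabs_mult; apply Rmult_le_compat; try apply Rabs_pos; lra. }
    apply Rle_trans with (1 := Rabs_triang _ _); rewrite Rabs_Ropp.
    generalize (Rabs_triang (A' - A) ((r s' - r s) * x)); lra. }
  assert (Hc := Hmul _ _ _ _ _ (proj2 (Rabs_le_between _ _) (COS_bound th')) Hx Ha eq_refl).
  assert (Hsn := Hmul _ _ _ _ _ (proj2 (Rabs_le_between _ _) (SIN_bound th')) Hy Hb eq_refl).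
  assert (Hq : forall B, Rabs (r s) * Rabs B <= 3 * eta -> Rabs B <= (1 - cos e) / 2).
  { intros B HB; apply (Rmult_le_reg_l (Rabs (r s))); trivial.
    unfold eta in HB; lra. }
  apply Hq in Hc; apply Hq in Hsn.
  (* The squares of the two variations add up to [2 - 2 * cos (th' - th)]. As [0 < cos e], the
     square of [(1 - cos e) / 2] is at most [(1 - cos e) / 4], which is more than enough. *)
  assert (Hcos : cos e < cos (th' - th)).
  { rewrite cos_minus.
    assert (C1 := cos2_sin2 th); assert (C2 := cos2_sin2 th').
    assert (He0 : 0 < cos e) by (apply cos_gt_0; lra).
    apply Rabs_le_between in Hc; apply Rabs_le_between in Hsn.
    assert (Hsq : forall z, - ((1 - cos e) / 2) <= z <= (1 - cos e) / 2 ->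
      z * z <= (1 - cos e) / 4) by (intros; nra).
    assert (Q1 := Hsq _ Hc); assert (Q2 := Hsq _ Hsn); nra. }
  apply cos_near_max in Hcos; [|lra].
  destruct Hcos as [k Hk]; exists k.
  replace (th' + 2 * IZR k * PI - th) with (th' - th + 2 * IZR k * PI) by ring; lra.
Qed.

Lemma radial_normal_neq0 (w h1 : R) (r th : R) :
  r <> 0 ->
  ((r * (- h1 * cos th), r * (- h1 * sin th), r * w) : V3) <> vzero <-> ~ (h1 = 0 /\ w = 0).
Proof.
  intro r0; unfold vzero; split; intros H E.
  - destruct E as [-> ->]; apply H; f_equal; [f_equal|]; ring.
  - apply H; injection E as E1 E2 E3.
    apply Rmult_integral in E1, E2, E3.
    destruct E1 as [E1|E1], E2 as [E2|E2], E3 as [E3|E3]; try easy; split; trivial.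
    transitivity (- (- h1 * (cos th * cos th + sin th * sin th))).
    + rewrite cos2_sin2; ring.
    + transitivity (- (- h1 * cos th * cos th + - h1 * sin th * sin th)); [ring|].
      rewrite E1, E2; ring.
Qed.

(** The right sides are the reflection of the unit vector [(cos th, sin th)] in the line spanned by
    [(x, y)], with normal [(y, - x)], in the form to which [reflect_vertical] unfolds. *)
Lemma reflect_angle (x y th : R) :
  x ^ 2 + y ^ 2 <> 0 ->
  exists th', cos th' = cos th - 2 * (y * cos th - x * sin th) / (y ^ 2 + (- x) ^ 2) * y /\
              sin th' = sin th - 2 * (y * cos th - x * sin th) / (y ^ 2 + (- x) ^ 2) * - x.
Proof.
  intro H; apply angle_exists.
  transitivity (cos th * cos th + sin th * sin th); [|apply cos2_sin2].
  field; lra.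
Qed.

(** * Curvature, embeddedness and symmetry of the three families *)

Section FamilySurface.
Variables (T : solution_type) (c lam mu : R) (lo hi : Rbar).
Hypothesis (Hadm : admissible T c lam mu lo hi).
Let X := family_surface T c lam mu.
Let rho := fam_rho T c (sqrt (lam ^ 2 + mu ^ 2)).
Let sg := fam_sigma T c (sqrt (lam ^ 2 + mu ^ 2)).

Lemma radius_neq0 s : in_itv lo hi s -> radius T c lam mu s <> 0.
Proof.
  destruct Hadm as (c0 & k0 & _ & Hdom); intro Hs.
  rewrite radius_rho by auto.
  apply Rinv_neq_0_compat, in_domain_rho; auto.
Qed.

Lemma family_normal_vz s th :
  let w := lam / rho s ^ 2 * cos th + mu / rho s ^ 2 * sin th + - sg s / rho s ^ 2 in
  in_itv lo hi s -> vz (normal X s th) <> 0 <-> w <> 0.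
Proof.
  destruct Hadm as (c0 & k0 & _ & Hdom); intros w Hs.
  assert (r0 := radius_neq0 s Hs).
  apply (normal_vz _ _ _ _ (fun u => lam / rho u ^ 2) (fun u => mu / rho u ^ 2) (fun _ => 1)
    (fun u => - sg u / rho u ^ 2)); trivial.
  - apply center_x_derive; auto.
  - apply center_y_derive; auto.
  - exact (is_derive_id s).
  - apply radius_derive; auto.
Qed.

(** Since [(lam, mu)] is not zero, [w] is a nonconstant trigonometric polynomial on each circle, so
    moving [th] alone leaves the vertical tangent planes. The numerator of the curvature is a
    multiple of [lam ^ 2 + mu ^ 2 - (sg ^ 2 - fam_E T c * rho ^ 2)], which is zero by the
    conservation law. *)
Lemma family_CAMC : CAMC lo hi X 0.
Proof.
  destruct Hadm as (c0 & k0 & _ & Hdom).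
  assert (Hrho : forall s, in_itv lo hi s -> rho s <> 0).
  { intros s Hs; apply in_domain_rho; auto. }
  split.
  - intros s th eps Hs He.
    assert (HR := Hrho s Hs).
    destruct (trig_dense_neq0 (lam / rho s ^ 2) (mu / rho s ^ 2) (- sg s / rho s ^ 2) th eps)
      as (th' & Hth & H0); trivial.
    { replace ((lam / rho s ^ 2) ^ 2 + (mu / rho s ^ 2) ^ 2)
        with ((lam ^ 2 + mu ^ 2) * (/ rho s ^ 4)) by (field; trivial).
      apply Rmult_integral_contrapositive_currified; trivial.
      apply Rinv_neq_0_compat, pow_nonzero; trivial. }
    exists s, th'; repeat split; trivial; try apply Hs.
    + rewrite Rminus_diag, Rabs_R0; trivial.
    + now apply family_normal_vz.
  - intros s th Hs H0; apply family_normal_vz in H0; trivial.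
    assert (HR := Hrho s Hs); assert (r0 := radius_neq0 s Hs).
    assert (Hd := Hdom s Hs).
    assert (Hh : jet2 (fun u : R => u) (fun _ => 1) 0 s).
    { split; [apply filter_forall; intro x; exact (is_derive_id x)|exact (is_derive_const 1 s)]. }
    unfold X, family_surface.
    rewrite (circles_amc _ _ _ _ _ _ _ _ _ _ _ _ s th
      (center_x_jet2 T c lam mu c0 k0 s Hd) (center_y_jet2 T c lam mu c0 k0 s Hd) Hh
      (radius_jet2 T c lam mu c0 k0 s Hd) r0 H0).
    rewrite radius_rho by trivial.
    fold rho sg; unfold Rdiv at 1; apply Rmult_eq_0_compat_r.
    assert (C := fam_conserved T c (sqrt (lam ^ 2 + mu ^ 2)) s c0); fold rho sg in C.
    replace (sqrt (lam ^ 2 + mu ^ 2) ^ 2) with (lam ^ 2 + mu ^ 2) in C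
        by (symmetry; transitivity (sqrt (lam ^ 2 + mu ^ 2) * sqrt (lam ^ 2 + mu ^ 2));
            [ring|apply sqrt_sqrt; nra]).
    transitivity (2 / rho s ^ 4 * ((lam ^ 2 + mu ^ 2) * (cos th * cos th + sin th * sin th)
        - (sg s ^ 2 - fam_E T c * rho s ^ 2))); [field; trivial|].
    rewrite C, cos2_sin2; ring.
Qed.

Lemma family_immersed : immersed lo hi X.
Proof.
  destruct Hadm as (c0 & k0 & _ & Hdom); intros s th Hs.
  assert (r0 := radius_neq0 s Hs); assert (Hd := Hdom s Hs).
  unfold X, family_surface.
  rewrite (circles_cross _ _ _ _ (fun u => lam / rho u ^ 2) (fun u => mu / rho u ^ 2)
    (fun _ => 1) (fun u => - sg u / rho u ^ 2)).
  - apply radial_normal_neq0; trivial; lra.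
  - now apply center_x_derive.
  - now apply center_y_derive.
  - exact (is_derive_id s).
  - now apply radius_derive.
Qed.

Lemma family_embedded : embedded lo hi X.
Proof.
  split; [exact family_immersed|split].
  - intros s th s' th' Hs Hs'; apply circles_injective; now apply radius_neq0.
  - intros s th eps Hs He.
    destruct Hadm as (c0 & k0 & _ & Hdom); assert (Hd := Hdom s Hs).
    destruct (circles_inverse_continuous (center_x T c lam mu) (center_y T c lam mu)
      (radius T c lam mu) s th eps) as (d & d0 & H); trivial.
    + apply (ex_derive_continuous (center_x T c lam mu)); eexists; now apply center_x_derive.
    + apply (ex_derive_continuous (center_y T c lam mu)); eexists; now apply center_y_derive.
    + apply (ex_derive_continuous (radius T c lam mu)); eexists; now apply radius_derive.
    + now apply radius_neq0.
    + exists d; split; trivial; intros s' th' _; apply H.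
Qed.

(** The horizontal position of each center is a multiple of [(lam, mu)], so the reflection fixes the
    centers and maps each circle to itself. *)
Lemma family_symmetric :
  (mu, - lam) <> (0, 0) /\
  (forall s, in_itv lo hi s ->
     vertical_plane mu (- lam) 0 (center_x T c lam mu s, center_y T c lam mu s, s)) /\
  symmetric_about mu (- lam) 0 (trace lo hi X).
Proof.
  destruct Hadm as (c0 & k0 & _ & Hdom).
  assert (HP : forall s, in_itv lo hi s ->
     mu * center_x T c lam mu s = lam * center_y T c lam mu s).
  { intros s Hs; rewrite center_x_rho, center_y_rho by auto; unfold Rdiv; ring. }
  split; [|split].
  - intro E; injection E as E1 E2; apply k0; nra.
  - intros s Hs; unfold vertical_plane, vx, vy; cbn [fst snd]; specialize (HP s Hs); lra.
  - intros p (s & th & Hs & ->).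
    destruct (reflect_angle lam mu th k0) as (th' & Hc & Hsn).
    exists s, th'; split; trivial.
    unfold X, family_surface, circles, reflect_vertical, vsub, vadd, vscal, vx, vy, vz.
    cbn [fst snd]; rewrite Hc, Hsn; specialize (HP s Hs).
    assert (mu ^ 2 + (- lam) ^ 2 <> 0) by nra.
    apply V3_eq.
    + transitivity (center_x T c lam mu s + radius T c lam mu s * cos th
        - 2 * (mu * center_x T c lam mu s - lam * center_y T c lam mu s
               + radius T c lam mu s * (mu * cos th - lam * sin th)) / (mu ^ 2 + (- lam) ^ 2) * mu);
        [field; trivial|rewrite HP; field; trivial].
    + transitivity (center_y T c lam mu s + radius T c lam mu s * sin th
        - 2 * (mu * center_x T c lam mu s - lam * center_y T c lam mu s
               + radius T c lam mu s * (mu * cos th - lam * sin th)) / (mu ^ 2 + (- lam) ^ 2) * - lam);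
        [field; trivial|rewrite HP; field; trivial].
    + field; trivial.
Qed.

End FamilySurface.

(** * The equations of a foliated CAMC surface *)

Lemma linear_form_zero (A B C : R) :
  (forall x y, x ^ 2 + y ^ 2 = 1 -> A + B * x + C * y = 0) -> A = 0 /\ B = 0 /\ C = 0.
Proof.
  intro H.
  assert (H1 := H 1 0 ltac:(ring)); assert (H2 := H (- 1) 0 ltac:(ring)).
  assert (H3 := H 0 1 ltac:(ring)); repeat split; lra.
Qed.

(** The part of the identity that is odd under [(x, y) -> (- x, - y)], with [B] and [C] read off on
    the axes, says that the cube of [al * x + be * y] is itself linear on the circle; its third
    harmonic must then vanish. *)
Lemma cubic_form_linear (A B C al be ga K : R) :
  K <> 0 ->
  (forall x y, x ^ 2 + y ^ 2 = 1 -> A + B * x + C * y = K * (al * x + be * y + ga) ^ 3) ->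
  al = 0 /\ be = 0.
Proof.
  intros K0 H.
  assert (Hu : forall x y, x ^ 2 + y ^ 2 = 1 ->
     (al * x + be * y) ^ 3 = al ^ 3 * x + be ^ 3 * y).
  { intros x y Hxy; apply (Rmult_eq_reg_l K); trivial.
    assert (H1 := H 1 0 ltac:(ring)); assert (H2 := H (- 1) 0 ltac:(ring)).
    assert (H3 := H 0 1 ltac:(ring)); assert (H4 := H 0 (- 1) ltac:(ring)).
    assert (H5 := H x y Hxy); assert (H6 := H (- x) (- y) ltac:(rewrite <- Hxy; ring)).
    assert (EB : B = K * (al ^ 3 + 3 * ga ^ 2 * al)) by lra.
    assert (EC : C = K * (be ^ 3 + 3 * ga ^ 2 * be)) by lra.
    assert (E : B * x + C * y
      = K * ((al * x + be * y) ^ 3 + 3 * ga ^ 2 * (al * x + be * y))) by lra.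
    rewrite EB, EC in E; lra. }
  (* Rational points suffice: together the two equations read
     [al^3 = 3 al be^2] and [be^3 = 3 al^2 be]. *)
  assert (E1 := Hu (3 / 5) (4 / 5) ltac:(field)).
  assert (E2 := Hu (3 / 5) (- 4 / 5) ltac:(field)).
  assert (F1 : al * (al ^ 2 - 3 * be ^ 2) = 0) by lra.
  assert (F2 : be * (be ^ 2 - 3 * al ^ 2) = 0) by lra.
  apply Rmult_integral in F1, F2.
  destruct F1 as [F1|F1], F2 as [F2|F2]; try (split; nra).
Qed.

(** If [C ^ 2 = A ^ 2 + B ^ 2] with [C] nonzero, the point [(- A / C, - B / C)] lies on the circle
    and is a zero of the affine function; if [C = 0], the function is identically zero. *)
Lemma nonvanishing_on_circle (A B C : R) :
  (forall x y, x ^ 2 + y ^ 2 = 1 -> A * x + B * y + C <> 0) -> C ^ 2 - A ^ 2 - B ^ 2 <> 0.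
Proof.
  intros H E.
  destruct (Req_dec C 0) as [->|C0].
  - apply (H 1 0); [ring|nra].
  - apply (H (- A / C) (- B / C)).
    + transitivity ((A ^ 2 + B ^ 2) / C ^ 2); [field; trivial|].
      replace (A ^ 2 + B ^ 2) with (C ^ 2) by lra; field; trivial.
    + transitivity ((C ^ 2 - A ^ 2 - B ^ 2) / C); [field; trivial|].
      rewrite E; field; trivial.
Qed.

Section Equation.
Variables (lo hi : Rbar) (a b h r : R -> R) (Lambda : R).
Hypothesis HF : foliated_by_circles lo hi a b h r.
Hypothesis HC : CAMC lo hi (circles a b h r) Lambda.
Let a1 := Derive a.  Let b1 := Derive b.  Let h1 := Derive h.  Let r1 := Derive r.
Let a2 := Derive a1.  Let b2 := Derive b1.  Let h2 := Derive h1.  Let r2 := Derive r1.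
Let w (t x y : R) : R := a1 t * x + b1 t * y + r1 t.

Lemma continuity_2d_pt_fst (f : R -> R) t th :
  ex_derive f t -> continuity_2d_pt (fun u _ => f u) t th.
Proof.
  intro H; apply (continuity_1d_2d_pt_comp f (fun u _ => u)).
  - now apply continuity_pt_filterlim, (ex_derive_continuous f).
  - apply continuity_2d_pt_id1.
Qed.

(** Points of the unit circle replace the angle, so that the harmonics can be separated by
    evaluating at a few of them. *)
Lemma camc_equation t x y :
  in_itv lo hi t -> x ^ 2 + y ^ 2 = 1 ->
  2 * (r t * (h2 t * w t x y - h1 t * (a2 t * x + b2 t * y + r2 t))
       + h1 t * ((b1 t * x - a1 t * y) ^ 2 + w t x y ^ 2))
  = Lambda * (r t * w t x y ^ 3).
Proof.
  intros Ht Hxy; destruct (angle_exists x y Hxy) as (th & <- & <-).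
  destruct HF as (_ & Sa & Sb & Sh & Sr & Hr & _).
  (* Both sides are continuous and agree on the dense set [vz (normal X) <> 0]. *)
  apply Rminus_diag_uniq, NNPP; intro Hne.
  set (G := fun t th => 2 * (r t * (h2 t * w t (cos th) (sin th)
        - h1 t * (a2 t * cos th + b2 t * sin th + r2 t))
       + h1 t * ((b1 t * cos th - a1 t * sin th) ^ 2 + w t (cos th) (sin th) ^ 2))
       - Lambda * (r t * w t (cos th) (sin th) ^ 3)).
  assert (HG : continuity_2d_pt G t th).
  { assert (Hc : continuity_2d_pt (fun _ v => cos v) t th).
    { apply continuity_1d_2d_pt_comp; [apply continuity_cos|apply continuity_2d_pt_id2]. }
    assert (Hs : continuity_2d_pt (fun _ v => sin v) t th).
    { apply continuity_1d_2d_pt_comp; [apply continuity_sin|apply continuity_2d_pt_id2]. }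
    unfold G, w; simpl.
    (* Smoothness of order [n] says that the derivative of order [n - 1] is differentiable, hence
       continuous; the second derivatives in the equation therefore call for order 3. *)
    repeat first
      [ assumption
      | apply continuity_2d_pt_const
      | apply continuity_2d_pt_minus
      | apply continuity_2d_pt_plus
      | apply continuity_2d_pt_mult
      | apply continuity_2d_pt_fst;
        first [ exact (Sa t Ht 2%nat) | exact (Sb t Ht 2%nat)
              | exact (Sh t Ht 2%nat) | exact (Sr t Ht 2%nat)
              | exact (Sa t Ht 3%nat) | exact (Sb t Ht 3%nat)
              | exact (Sh t Ht 3%nat) | exact (Sr t Ht 3%nat)
              | exact (Sr t Ht 1%nat) ] ]. }
  destruct (continuity_2d_pt_neq_0 G t th HG Hne) as [d Hd].
  destruct (proj1 HC t th d Ht (cond_pos d)) as (t' & th' & Ht' & Hdt & Hdth & Hz).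
  apply (Hd t' th' Hdt Hdth).
  assert (Ja := smooth_jet2 _ _ _ _ Sa Ht'); assert (Jb := smooth_jet2 _ _ _ _ Sb Ht').
  assert (Jh := smooth_jet2 _ _ _ _ Sh Ht'); assert (Jr := smooth_jet2 _ _ _ _ Sr Ht').
  assert (r0 := Hr t' Ht').
  assert (HL := proj2 HC t' th' Ht' Hz).
  apply (normal_vz a b h r a1 b1 h1 r1) in Hz;
    [|now apply (locally_singleton _ _ (proj1 Ja))|now apply (locally_singleton _ _ (proj1 Jb))
     |now apply (locally_singleton _ _ (proj1 Jh))|now apply (locally_singleton _ _ (proj1 Jr))
     |lra].
  rewrite (circles_amc _ _ _ _ _ _ _ _ _ _ _ _ _ _ Ja Jb Jh Jr) in HL; [|lra|exact Hz].
  unfold G; rewrite <- HL; unfold w, a2, b2, h2, r2; fold a1 b1 h1 r1.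
  field; split; [exact Hz|lra].
Qed.

Lemma camc_nonzero_case t : in_itv lo hi t -> Lambda <> 0 -> a1 t = 0 /\ b1 t = 0.
Proof.
  intros Ht L0; destruct HF as (_ & _ & _ & _ & _ & Hr & _).
  specialize (Hr t Ht).
  apply (cubic_form_linear
    (2 * (r t * (h2 t * r1 t - h1 t * r2 t) + h1 t * (a1 t ^ 2 + b1 t ^ 2 + r1 t ^ 2)))
    (2 * (r t * (h2 t * a1 t - h1 t * a2 t) + 2 * h1 t * r1 t * a1 t))
    (2 * (r t * (h2 t * b1 t - h1 t * b2 t) + 2 * h1 t * r1 t * b1 t))
    _ _ (r1 t) (Lambda * r t)).
  - apply Rmult_integral_contrapositive_currified; lra.
  - intros x y Hxy; rewrite (Rmult_assoc Lambda); fold (w t x y).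
    rewrite <- camc_equation by trivial.
    (* The quadratic terms of the two squares add up to a multiple of [x ^ 2 + y ^ 2], constant on
       the circle; this is why no second harmonic survives. *)
    replace ((b1 t * x - a1 t * y) ^ 2 + w t x y ^ 2) with
      ((a1 t ^ 2 + b1 t ^ 2) * (x ^ 2 + y ^ 2) + r1 t ^ 2 + 2 * r1 t * (a1 t * x + b1 t * y))
      by (unfold w; ring).
    rewrite Hxy; unfold w; ring.
Qed.

Lemma camc_zero_case t :
  in_itv lo hi t -> Lambda = 0 ->
  r t * (h2 t * r1 t - h1 t * r2 t) + h1 t * (a1 t ^ 2 + b1 t ^ 2 + r1 t ^ 2) = 0 /\
  r t * (h2 t * a1 t - h1 t * a2 t) + 2 * h1 t * r1 t * a1 t = 0 /\
  r t * (h2 t * b1 t - h1 t * b2 t) + 2 * h1 t * r1 t * b1 t = 0.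
Proof.
  intros Ht L0; apply linear_form_zero; intros x y Hxy.
  assert (E := camc_equation t x y Ht Hxy).
  replace ((b1 t * x - a1 t * y) ^ 2 + w t x y ^ 2) with
      ((a1 t ^ 2 + b1 t ^ 2) * (x ^ 2 + y ^ 2) + r1 t ^ 2 + 2 * r1 t * (a1 t * x + b1 t * y)) in E
      by (unfold w; ring).
  rewrite Hxy, L0 in E; unfold w in E; lra.
Qed.

Lemma centers_fixed_revolution t0 :
  in_itv lo hi t0 -> (forall t, in_itv lo hi t -> a1 t = 0 /\ b1 t = 0) ->
  (forall t, in_itv lo hi t -> a t = a t0 /\ b t = b t0) /\
  revolution_about (a t0) (b t0) (trace lo hi (circles a b h r)).
Proof.
  intros Ht0 H; destruct HF as (_ & Sa & Sb & _).
  assert (HE : forall t, in_itv lo hi t -> a t = a t0 /\ b t = b t0).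
  { intros t Ht; split.
    - apply (itv_constant lo hi a); trivial; intros u Hu.
      rewrite <- (proj1 (H u Hu)); apply Derive_correct; exact (Sa u Hu 1%nat).
    - apply (itv_constant lo hi b); trivial; intros u Hu.
      rewrite <- (proj2 (H u Hu)); apply Derive_correct; exact (Sb u Hu 1%nat). }
  split; trivial.
  intros phi p (t & th & Ht & ->); exists t, (th + phi); split; trivial.
  destruct (HE t Ht) as [Ea Eb].
  unfold circles, rotate_vertical, vadd, vscal, vx, vy, vz; cbn [fst snd].
  rewrite Ea, Eb, cos_plus, sin_plus; apply V3_eq; ring.
Qed.

Lemma immersed_w t x y :
  in_itv lo hi t -> x ^ 2 + y ^ 2 = 1 -> h1 t = 0 -> w t x y <> 0.
Proof.
  intros Ht Hxy H0 Hw; destruct (angle_exists x y Hxy) as (th & <- & <-).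
  destruct HF as (_ & Sa & Sb & Sh & Sr & Hr & Him).
  specialize (Him t th Ht).
  rewrite (circles_cross a b h r a1 b1 h1 r1) in Him;
    [|apply Derive_correct; exact (Sa t Ht 1%nat)|apply Derive_correct; exact (Sb t Ht 1%nat)
     |apply Derive_correct; exact (Sh t Ht 1%nat)|apply Derive_correct; exact (Sr t Ht 1%nat)].
  apply radial_normal_neq0 in Him; [now apply Him|].
  specialize (Hr t Ht); lra.
Qed.

(** Serves to exclude vertical cylinders, on which [w] vanishes identically; the density clause of
    [CAMC] provides the point. *)
Lemma some_w_neq0 : exists t x y, in_itv lo hi t /\ w t x y <> 0.
Proof.
  destruct HF as (Hlt & Sa & Sb & Sh & Sr & Hr & _).
  destruct (itv_inhabited lo hi Hlt) as [t Ht].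
  destruct (proj1 HC t 0 1 Ht Rlt_0_1) as (t' & th & Ht' & _ & _ & Hz).
  exists t', (cos th), (sin th); split; trivial.
  apply (normal_vz a b h r a1 b1 h1 r1) in Hz; trivial;
    try (apply Derive_correct;
      first [exact (Sa t' Ht' 1%nat)|exact (Sb t' Ht' 1%nat)
            |exact (Sh t' Ht' 1%nat)|exact (Sr t' Ht' 1%nat)]).
  specialize (Hr t' Ht'); lra.
Qed.

End Equation.

(** * Integration for [Lambda = 0] *)

Section FirstIntegrals.
Variables (lo hi : Rbar) (h r a1 b1 h1 r1 a2 b2 h2 r2 : R -> R).
Hypothesis Dr : forall t, in_itv lo hi t -> is_derive r t (r1 t).
Hypothesis Da1 : forall t, in_itv lo hi t -> is_derive a1 t (a2 t).
Hypothesis Db1 : forall t, in_itv lo hi t -> is_derive b1 t (b2 t).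
Hypothesis Dh1 : forall t, in_itv lo hi t -> is_derive h1 t (h2 t).
Hypothesis Dr1 : forall t, in_itv lo hi t -> is_derive r1 t (r2 t).
Hypothesis r_pos : forall t, in_itv lo hi t -> 0 < r t.
Hypothesis eq_r : forall t, in_itv lo hi t ->
  r t * (h2 t * r1 t - h1 t * r2 t) + h1 t * (a1 t ^ 2 + b1 t ^ 2 + r1 t ^ 2) = 0.
Hypothesis eq_a : forall t, in_itv lo hi t ->
  r t * (h2 t * a1 t - h1 t * a2 t) + 2 * h1 t * r1 t * a1 t = 0.
Hypothesis eq_b : forall t, in_itv lo hi t ->
  r t * (h2 t * b1 t - h1 t * b2 t) + 2 * h1 t * r1 t * b1 t = 0.

Lemma height_dichotomy :
  (forall t, in_itv lo hi t -> h1 t = 0 -> r1 t ^ 2 - a1 t ^ 2 - b1 t ^ 2 <> 0) ->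
  (forall t, in_itv lo hi t -> h1 t = 0) \/ (forall t, in_itv lo hi t -> h1 t <> 0).
Proof.
  intro Hq.
  (* The equations say that the plane vector [(p, q)], which never vanishes, keeps a
     constant direction: if [p] vanishes once, it vanishes identically. *)
  set (p := fun t => (h1 t * r t) ^ 2).
  set (q := fun t => r1 t ^ 2 - a1 t ^ 2 - b1 t ^ 2).
  assert (Hpq : forall t, in_itv lo hi t -> p t ^ 2 + q t ^ 2 <> 0).
  { intros t Ht E; specialize (r_pos t Ht).
    assert (Hp0 : p t = 0) by nra; assert (Hq0 : q t = 0) by nra.
    apply (Hq t Ht); trivial.
    unfold p in Hp0; simpl in Hp0; rewrite Rmult_1_r in Hp0.
    apply Rmult_integral in Hp0; destruct Hp0 as [H|H];
      apply Rmult_integral in H; destruct H; trivial; lra. }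
  (* The quotient is the squared cosine of the angle of the vector [(p, q)]; unlike [E = q / p], it
     is defined also where [h1] vanishes. *)
  assert (Hc : forall t, in_itv lo hi t ->
     is_derive (fun t => p t ^ 2 / (p t ^ 2 + q t ^ 2)) t 0).
  { intros t Ht; specialize (r_pos t Ht); specialize (Hpq t Ht).
    assert (Er := eq_r t Ht); assert (Ea := eq_a t Ht); assert (Eb := eq_b t Ht).
    assert (dr := Dr t Ht); assert (dr1 := Dr1 t Ht); assert (dh1 := Dh1 t Ht).
    assert (da1 := Da1 t Ht); assert (db1 := Db1 t Ht).
    set (p' := 2 * (h1 t * r t) * (h2 t * r t + h1 t * r1 t)).
    set (q' := 2 * r1 t * r2 t - 2 * a1 t * a2 t - 2 * b1 t * b2 t).
    assert (dp : is_derive p t p').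
    { unfold p, p'; auto_derive; [repeat split; eexists; eassumption|].
      rewrite_derive dr; rewrite_derive dh1; ring. }
    assert (dq : is_derive q t q').
    { unfold q, q'; auto_derive; [repeat split; eexists; eassumption|].
      rewrite_derive dr1; rewrite_derive da1; rewrite_derive db1; ring. }
    (* Constancy of the direction amounts to the vanishing of this Wronskian. *)
    assert (Wr : p t * q' - q t * p' = 0).
    { unfold p, q, p', q'.
      transitivity (- 2 * h1 t * r t * (
          r1 t * (r t * (h2 t * r1 t - h1 t * r2 t) + h1 t * (a1 t ^ 2 + b1 t ^ 2 + r1 t ^ 2))
        - a1 t * (r t * (h2 t * a1 t - h1 t * a2 t) + 2 * h1 t * r1 t * a1 t)
        - b1 t * (r t * (h2 t * b1 t - h1 t * b2 t) + 2 * h1 t * r1 t * b1 t))); [ring|].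
      rewrite Er, Ea, Eb; ring. }
    auto_derive.
    - repeat split; try (eexists; eassumption); simpl in Hpq; trivial.
    - rewrite_derive dp; rewrite_derive dq.
      transitivity (- 2 * p t * q t * (p t * q' - q t * p') / (p t ^ 2 + q t ^ 2) ^ 2);
        [field; trivial|rewrite Wr; field; trivial]. }
  destruct (classic (exists t0, in_itv lo hi t0 /\ h1 t0 = 0)) as [(t0 & Ht0 & H0)|Hno].
  - left; intros t Ht; specialize (r_pos t Ht).
    assert (E := itv_constant lo hi _ Hc t t0 Ht Ht0); cbv beta in E.
    assert (Hp0 : p t0 = 0) by (unfold p; rewrite H0; ring).
    replace (p t0 ^ 2 / (p t0 ^ 2 + q t0 ^ 2)) with 0 in E
      by (rewrite Hp0; unfold Rdiv; ring).
    unfold Rdiv in E; apply Rmult_integral in E; destruct E as [E|E].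
    + assert (Hp : p t = 0) by nra.
      unfold p in Hp; simpl in Hp; rewrite Rmult_1_r in Hp.
      apply Rmult_integral in Hp; destruct Hp as [H|H];
        apply Rmult_integral in H; destruct H; trivial; lra.
    + now apply Rinv_neq_0_compat in E; [|apply Hpq].
  - right; intros t Ht H; apply Hno; eauto.
Qed.

Hypothesis h1_neq0 : forall t, in_itv lo hi t -> h1 t <> 0.

Lemma center_first_integral (f1 f2 : R -> R) :
  (forall t, in_itv lo hi t -> is_derive f1 t (f2 t)) ->
  (forall t, in_itv lo hi t ->
     r t * (h2 t * f1 t - h1 t * f2 t) + 2 * h1 t * r1 t * f1 t = 0) ->
  forall t, in_itv lo hi t -> is_derive (fun t => f1 t / (r t ^ 2 * h1 t)) t 0.
Proof.
  intros Df1 eq_f t Ht; specialize (r_pos t Ht); specialize (h1_neq0 t Ht).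
  assert (Ef := eq_f t Ht); assert (df1 := Df1 t Ht).
  assert (dr := Dr t Ht); assert (dh1 := Dh1 t Ht).
  assert (r t <> 0) by lra.
  auto_derive.
  - repeat split; try (eexists; eassumption).
    change (r t ^ 2 * h1 t <> 0).
    apply Rmult_integral_contrapositive_currified; trivial; now apply pow_nonzero.
  - rewrite_derive dr; rewrite_derive dh1; rewrite_derive df1.
    transitivity (- (r t * (h2 t * f1 t - h1 t * f2 t) + 2 * h1 t * r1 t * f1 t)
      / (r t ^ 3 * h1 t ^ 2)); [field; split; trivial|rewrite Ef; field; split; trivial].
Qed.

Lemma energy_first_integral t :
  in_itv lo hi t ->
  is_derive (fun t => (r1 t ^ 2 - a1 t ^ 2 - b1 t ^ 2) / (h1 t * r t) ^ 2) t 0.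
Proof.
  intro Ht; specialize (r_pos t Ht); specialize (h1_neq0 t Ht).
  assert (Er := eq_r t Ht); assert (Ea := eq_a t Ht); assert (Eb := eq_b t Ht).
  assert (dr := Dr t Ht); assert (dr1 := Dr1 t Ht); assert (dh1 := Dh1 t Ht).
  assert (da1 := Da1 t Ht); assert (db1 := Db1 t Ht).
  assert (r t <> 0) by lra.
  auto_derive.
  - repeat split; try (eexists; eassumption).
    change ((h1 t * r t) ^ 2 <> 0).
    now apply pow_nonzero, Rmult_integral_contrapositive_currified.
  - rewrite_derive dr; rewrite_derive dr1; rewrite_derive dh1;
      rewrite_derive da1; rewrite_derive db1.
    transitivity (- 2 * (
          r1 t * (r t * (h2 t * r1 t - h1 t * r2 t) + h1 t * (a1 t ^ 2 + b1 t ^ 2 + r1 t ^ 2))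
        - a1 t * (r t * (h2 t * a1 t - h1 t * a2 t) + 2 * h1 t * r1 t * a1 t)
        - b1 t * (r t * (h2 t * b1 t - h1 t * b2 t) + 2 * h1 t * r1 t * b1 t))
        / (h1 t ^ 3 * r t ^ 3)); [field; split; trivial|].
    rewrite Er, Ea, Eb; field; split; trivial.
Qed.

(** [sg] is the derivative of [rho] with respect to the height, hence the factors [h1]: the system
    is used in the original parameter, without inverting [h]. The constants are the values of the
    first integrals at one point. *)
Lemma inverse_radius_system :
  Rbar_lt lo hi ->
  let rho t := / r t in
  let sg t := - r1 t / (r t ^ 2 * h1 t) in
  exists lam mu E : R, forall t, in_itv lo hi t ->
    a1 t = lam * r t ^ 2 * h1 t /\ b1 t = mu * r t ^ 2 * h1 t /\
    sg t ^ 2 - E * rho t ^ 2 = lam ^ 2 + mu ^ 2 /\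
    is_derive rho t (sg t * h1 t) /\ is_derive sg t (E * rho t * h1 t).
Proof.
  intros Hlt rho sg; destruct (itv_inhabited lo hi Hlt) as [t0 Ht0].
  exists (a1 t0 / (r t0 ^ 2 * h1 t0)), (b1 t0 / (r t0 ^ 2 * h1 t0)),
    ((r1 t0 ^ 2 - a1 t0 ^ 2 - b1 t0 ^ 2) / (h1 t0 * r t0) ^ 2).
  intros t Ht.
  assert (La := itv_constant lo hi _ (center_first_integral a1 a2 Da1 eq_a) t t0 Ht Ht0).
  assert (Lb := itv_constant lo hi _ (center_first_integral b1 b2 Db1 eq_b) t t0 Ht Ht0).
  assert (LE := itv_constant lo hi _ energy_first_integral t t0 Ht Ht0).
  cbv beta in La, Lb, LE; rewrite <- La, <- Lb, <- LE.
  assert (Hrt := r_pos t Ht); assert (Hh := h1_neq0 t Ht); assert (r t <> 0) by lra.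
  assert (dr := Dr t Ht); assert (dr1 := Dr1 t Ht); assert (dh1 := Dh1 t Ht).
  assert (Er := eq_r t Ht).
  split; [field; split; trivial|split; [field; split; trivial|split; [|split]]].
  - unfold sg, rho; field; split; trivial.
  - unfold sg, rho; auto_derive; [repeat split; try (eexists; eassumption); trivial|].
    rewrite_derive dr; field; split; trivial.
  - unfold sg, rho; auto_derive.
    + repeat split; try (eexists; eassumption).
      change (r t ^ 2 * h1 t <> 0).
      apply Rmult_integral_contrapositive_currified; trivial; now apply pow_nonzero.
    + rewrite_derive dr; rewrite_derive dr1; rewrite_derive dh1.
      transitivity ((r t * (h2 t * r1 t - h1 t * r2 t) + h1 t * (a1 t ^ 2 + b1 t ^ 2 + r1 t ^ 2)
        + h1 t * (r1 t ^ 2 - a1 t ^ 2 - b1 t ^ 2)) / (r t ^ 3 * h1 t ^ 2));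
        [field; split; trivial|rewrite Er; field; split; trivial].
Qed.

End FirstIntegrals.

(** * Explicit solutions of [rho'' = E * rho], with the height as variable *)

Section Integration.
Variables (lo hi : Rbar) (h h1 rho sg : R -> R) (E k : R).
Hypothesis nonempty : Rbar_lt lo hi.
Hypothesis Dh : forall t, in_itv lo hi t -> is_derive h t (h1 t).
Hypothesis Drho : forall t, in_itv lo hi t -> is_derive rho t (sg t * h1 t).
Hypothesis Dsg : forall t, in_itv lo hi t -> is_derive sg t (E * rho t * h1 t).
Hypothesis conserved : forall t, in_itv lo hi t -> sg t ^ 2 - E * rho t ^ 2 = k ^ 2.

(** The derivative of [sg / rho] is [- h1 * k ^ 2 / rho ^ 2], zero here. So [rho] is proportional to
    [exp (m * h)], which leads to the logarithmic surfaces. *)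
Lemma integrate_zero_k :
  k = 0 -> (forall t, in_itv lo hi t -> rho t <> 0) ->
  exists m, forall t, in_itv lo hi t -> sg t = m * rho t.
Proof.
  intros k0 Hrho; destruct (itv_inhabited lo hi nonempty) as [t0 Ht0].
  exists (sg t0 / rho t0); intros t Ht.
  rewrite <- (itv_constant lo hi (fun t => sg t / rho t)) with (x := t); trivial.
  - field; auto.
  - intros u Hu; assert (dr := Drho u Hu); assert (ds := Dsg u Hu).
    specialize (conserved u Hu); specialize (Hrho u Hu).
    auto_derive; [repeat split; try (eexists; eassumption); trivial|].
    rewrite_derive dr; rewrite_derive ds.
    transitivity (- h1 u * (sg u ^ 2 - E * rho u ^ 2) / rho u ^ 2); [field; trivial|].
    rewrite conserved, k0; field; trivial.
Qed.

Hypothesis k_pos : 0 < k.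

Lemma sign_cases (z : R) : z ^ 2 = k ^ 2 -> exists e, e * e = 1 /\ z = e * k.
Proof.
  intro H; assert (H' : (z - k) * (z + k) = 0) by nra.
  apply Rmult_integral in H'; destruct H'; [exists 1|exists (- 1)]; split; lra.
Qed.

Lemma integrate_parabolic :
  E = 0 ->
  exists c s0 e, c <> 0 /\ e * e = 1 /\
    forall t, in_itv lo hi t -> rho t = e * fam_rho TypeII c k (h t - s0).
Proof.
  intro E0; destruct (itv_inhabited lo hi nonempty) as [t0 Ht0].
  destruct (sign_cases (sg t0)) as (e & He & Hs0).
  { rewrite <- (conserved t0 Ht0), E0; ring. }
  assert (Hs : forall t, in_itv lo hi t -> sg t = e * k).
  { intros t Ht; rewrite <- Hs0; apply (itv_constant lo hi sg); trivial.
    intros u Hu; replace 0 with (E * rho u * h1 u) by (rewrite E0; ring); auto. }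
  set (n := rho t0 - e * k * h t0).
  assert (Hn : forall t, in_itv lo hi t -> rho t = e * k * h t + n).
  { intros t Ht; assert (rho t - e * k * h t = n); [|lra].
    apply (itv_constant lo hi (fun t => rho t - e * k * h t)); trivial.
    intros u Hu; assert (dr := Drho u Hu); assert (dh := Dh u Hu).
    auto_derive; [repeat split; eexists; eassumption|].
    rewrite_derive dr; rewrite_derive dh; rewrite (Hs u Hu); ring. }
  (* In type II the constant [c] can be changed by a vertical translation, so any nonzero value
     would do; [s0] is chosen to fit [c = 1]. *)
  exists 1, ((1 - e * n) / k), e; split; [lra|split; trivial].
  intros t Ht; rewrite (Hn t Ht); unfold fam_rho.
  transitivity (e * k * h t + e * e * n); [rewrite He; ring|field; lra].
Qed.

(** The coefficients [A] and [B] of the two exponentials are constant, and the conservation law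
    makes their product [k ^ 2]. Being positive, it rules out pure exponentials and hyperbolic
    cosines: [A] and [B] are [e * k * exp psi] and [e * k * exp (- psi)], and [psi] is the phase of
    the hyperbolic sine. *)
Lemma integrate_hyperbolic :
  0 < E ->
  exists c s0 e, c <> 0 /\ e * e = 1 /\
    forall t, in_itv lo hi t -> rho t = e * fam_rho TypeIII c k (h t - s0).
Proof.
  intro E0; destruct (itv_inhabited lo hi nonempty) as [t0 Ht0].
  set (c := sqrt E).
  assert (c0 : 0 < c) by now apply sqrt_lt_R0.
  assert (Hc : c * c = E) by (apply sqrt_sqrt; lra).
  set (A := fun t => (sg t - c * rho t) * exp (c * h t)).
  set (B := fun t => (sg t + c * rho t) * exp (- (c * h t))).
  assert (Hexp : forall z, exp z * exp (- z) = 1).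
  { intro z; rewrite <- exp_plus, Rplus_opp_r; apply exp_0. }
  assert (HA : forall t, in_itv lo hi t -> A t = A t0).
  { intros t Ht; apply (itv_constant lo hi A); trivial.
    intros u Hu; assert (dr := Drho u Hu); assert (ds := Dsg u Hu); assert (dh := Dh u Hu).
    unfold A; auto_derive; [repeat split; eexists; eassumption|].
    rewrite_derive dr; rewrite_derive dh; rewrite_derive ds; rewrite <- Hc; ring. }
  assert (HB : forall t, in_itv lo hi t -> B t = B t0).
  { intros t Ht; apply (itv_constant lo hi B); trivial.
    intros u Hu; assert (dr := Drho u Hu); assert (ds := Dsg u Hu); assert (dh := Dh u Hu).
    unfold B; auto_derive; [repeat split; eexists; eassumption|].
    rewrite_derive dr; rewrite_derive dh; rewrite_derive ds; rewrite <- Hc; ring. }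
  assert (HAB : A t0 * B t0 = k ^ 2).
  { rewrite <- (conserved t0 Ht0), <- Hc; unfold A, B.
    transitivity ((sg t0 ^ 2 - c * c * rho t0 ^ 2) * (exp (c * h t0) * exp (- (c * h t0))));
      [ring|rewrite Hexp; ring]. }
  assert (HAe : exists e psi, e * e = 1 /\ A t0 = e * k * exp psi /\ B t0 = e * k * exp (- psi)).
  { assert (A0 : A t0 <> 0) by (intro H; rewrite H in HAB; nra).
    assert (Habs : 0 < Rabs (A t0) / k).
    { apply Rdiv_lt_0_compat; trivial; now apply Rabs_pos_lt. }
    assert (HBk : B t0 = k * / (A t0 / k)).
    { apply (Rmult_eq_reg_l (A t0)); trivial; rewrite HAB; field; split; lra. }
    exists (sign (A t0)), (ln (Rabs (A t0) / k)).
    rewrite exp_Ropp, exp_ln by trivial; rewrite HBk.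
    unfold Rabs; destruct (Rcase_abs (A t0)) as [H|H].
    - rewrite sign_eq_m1 by trivial; repeat split; field; lra.
    - rewrite sign_eq_1 by lra; repeat split; field; lra. }
  destruct HAe as (e & psi & He & EA & EB).
  exists c, (psi / c), e; split; [lra|split; trivial].
  intros t Ht; unfold fam_rho, sinh.
  replace (c * (h t - psi / c)) with (c * h t + - psi) by (field; lra).
  replace (- (c * h t + - psi)) with (- (c * h t) + psi) by ring.
  rewrite !exp_plus.
  apply (Rmult_eq_reg_l (2 * c)); [|lra].
  transitivity (e * k * exp (- psi) * exp (c * h t) - e * k * exp psi * exp (- (c * h t)));
    [|field; lra].
  rewrite <- EA, <- EB, <- (HA t Ht), <- (HB t Ht); unfold A, B.
  transitivity (2 * c * rho t * (exp (c * h t) * exp (- (c * h t))));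
    [rewrite Hexp; ring|ring].
Qed.

(** As the height grows, the vector [(c * rho, sg)] turns at speed [c] on the circle of radius [k];
    [(A, B)] is this vector turned back, hence constant, and [psi] is its angle. The phase absorbs
    the sign, so [e = 1]. *)
Lemma integrate_elliptic :
  E < 0 ->
  exists c s0 e, c <> 0 /\ e * e = 1 /\
    forall t, in_itv lo hi t -> rho t = e * fam_rho TypeI c k (h t - s0).
Proof.
  intro E0; destruct (itv_inhabited lo hi nonempty) as [t0 Ht0].
  set (c := sqrt (- E)).
  assert (c0 : 0 < c) by (apply sqrt_lt_R0; lra).
  assert (Hc : c * c = - E) by (apply sqrt_sqrt; lra).
  assert (HE : E = - (c * c)) by lra.
  set (A := fun t => c * rho t * cos (c * h t) - sg t * sin (c * h t)).
  set (B := fun t => c * rho t * sin (c * h t) + sg t * cos (c * h t)).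
  assert (HA : forall t, in_itv lo hi t -> A t = A t0).
  { intros t Ht; apply (itv_constant lo hi A); trivial.
    intros u Hu; assert (dr := Drho u Hu); assert (ds := Dsg u Hu); assert (dh := Dh u Hu).
    unfold A; auto_derive; [repeat split; eexists; eassumption|].
    rewrite_derive dr; rewrite_derive dh; rewrite_derive ds; rewrite HE; ring. }
  assert (HB : forall t, in_itv lo hi t -> B t = B t0).
  { intros t Ht; apply (itv_constant lo hi B); trivial.
    intros u Hu; assert (dr := Drho u Hu); assert (ds := Dsg u Hu); assert (dh := Dh u Hu).
    unfold B; auto_derive; [repeat split; eexists; eassumption|].
    rewrite_derive dr; rewrite_derive dh; rewrite_derive ds; rewrite HE; ring. }
  destruct (angle_exists (A t0 / k) (B t0 / k)) as (psi & EA & EB).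
  { transitivity ((A t0 ^ 2 + B t0 ^ 2) / k ^ 2); [field; lra|].
    replace (A t0 ^ 2 + B t0 ^ 2) with (k ^ 2); [field; lra|].
    rewrite <- (conserved t0 Ht0), HE; unfold A, B.
    transitivity ((sg t0 ^ 2 + c * c * rho t0 ^ 2)
      * (cos (c * h t0) * cos (c * h t0) + sin (c * h t0) * sin (c * h t0)));
      [rewrite cos2_sin2|]; ring. }
  exists c, (psi / c), 1; split; [lra|split; [ring|]].
  intros t Ht; unfold fam_rho.
  replace (c * (h t - psi / c)) with (c * h t - psi) by (field; lra).
  rewrite cos_minus, EA, EB, <- (HA t Ht), <- (HB t Ht); unfold A, B.
  transitivity (rho t * (cos (c * h t) * cos (c * h t) + sin (c * h t) * sin (c * h t)));
    [rewrite cos2_sin2; ring|field; lra].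
Qed.

Lemma integrate_inverse_radius :
  exists T c s0 e, c <> 0 /\ e * e = 1 /\
    forall t, in_itv lo hi t -> rho t = e * fam_rho T c k (h t - s0).
Proof.
  destruct (Rtotal_order E 0) as [H|[H|H]].
  - exists TypeI; now apply integrate_elliptic.
  - exists TypeII; now apply integrate_parabolic.
  - exists TypeIII; now apply integrate_hyperbolic.
Qed.

End Integration.

(** A circle of radius [- r] is the circle of radius [r] with [th] shifted by [PI]. *)
Lemma angle_sign_flip (e th : R) :
  e * e = 1 -> exists th', cos th' = e * cos th /\ sin th' = e * sin th.
Proof.
  intro He; apply angle_exists.
  transitivity (e * e * (cos th * cos th + sin th * sin th)); [ring|].
  rewrite He, cos2_sin2; ring.
Qed.

(** * Recognition of the surfaces as point sets *)

(** Once the radii agree up to the sign [e], the centers have the same velocity as those of the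
    model, since it involves only the squared radius. They differ by a constant vector, which
    together with the phase [s0] is the translation; the new parameter interval is the image of
    [h - s0]. *)
Lemma circles_same_family (lo hi : Rbar) (a b h r a1 b1 h1 : R -> R)
    (T : solution_type) (c lam mu s0 e : R) :
  Rbar_lt lo hi ->
  (forall t, in_itv lo hi t -> is_derive a t (a1 t)) ->
  (forall t, in_itv lo hi t -> is_derive b t (b1 t)) ->
  (forall t, in_itv lo hi t -> is_derive h t (h1 t)) ->
  (forall t, in_itv lo hi t -> 0 < r t) ->
  (forall t, in_itv lo hi t -> h1 t <> 0) ->
  (forall t, in_itv lo hi t -> a1 t = lam * r t ^ 2 * h1 t) ->
  (forall t, in_itv lo hi t -> b1 t = mu * r t ^ 2 * h1 t) ->
  c <> 0 -> lam ^ 2 + mu ^ 2 <> 0 -> e * e = 1 ->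
  (forall t, in_itv lo hi t ->
     / r t = e * fam_rho T c (sqrt (lam ^ 2 + mu ^ 2)) (h t - s0)) ->
  exists (jlo jhi : Rbar) (v : V3),
    admissible T c lam mu jlo jhi /\
    same_set (trace lo hi (circles a b h r))
      (translate v (trace jlo jhi (family_surface T c lam mu))).
Proof.
  intros Hlt Da Db Dh r_pos h1_neq0 Ha Hb c0 k0 He Hrho.
  set (rho := fam_rho T c (sqrt (lam ^ 2 + mu ^ 2))) in *.
  assert (e0 : e <> 0) by (intro H; rewrite H in He; lra).
  assert (Hrho0 : forall t, in_itv lo hi t -> rho (h t - s0) <> 0).
  { intros t Ht H; specialize (Hrho t Ht); rewrite H, Rmult_0_r in Hrho.
    specialize (r_pos t Ht); apply Rinv_neq_0_compat in Hrho; lra. }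
  assert (Hdom : forall t, in_itv lo hi t -> in_domain T c lam mu (h t - s0)).
  { intros t Ht; apply in_domain_rho; auto. }
  assert (Hr : forall t, in_itv lo hi t -> r t = e * radius T c lam mu (h t - s0)).
  { intros t Ht; rewrite radius_rho by auto; fold rho.
    rewrite <- (Rinv_inv (r t)), (Hrho t Ht), Rinv_mult; f_equal.
    apply (Rmult_eq_reg_l e); trivial; rewrite He; field; trivial. }
  assert (Hcenter : forall (f f1 g : R -> R) (l : R),
     (forall t, in_itv lo hi t -> is_derive f t (f1 t)) ->
     (forall t, in_itv lo hi t -> f1 t = l * r t ^ 2 * h1 t) ->
     (forall s, in_domain T c lam mu s -> is_derive g s (l / rho s ^ 2)) ->
     forall t, in_itv lo hi t -> is_derive (fun t => f t - g (h t - s0)) t 0).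
  { intros f f1 g l Df Hf Dg t Ht.
    assert (df := Df t Ht); assert (dh := Dh t Ht); assert (dg := Dg _ (Hdom t Ht)).
    auto_derive; [repeat split; eexists; eassumption|].
    replace (h t + - s0) with (h t - s0) by ring.
    rewrite_derive df; rewrite_derive dh; rewrite_derive dg.
    rewrite (Hf t Ht), <- (Rinv_inv (r t)), (Hrho t Ht).
    transitivity (l * h1 t / rho (h t - s0) ^ 2 * (/ (e * e) - 1));
      [field; split; auto|rewrite He; field; auto]. }
  destruct (itv_image lo hi (fun t => h t - s0) h1) as (jlo & jhi & Hj & HJ); trivial.
  { intros t Ht; assert (dh := Dh t Ht).
    auto_derive; [eexists; eassumption|rewrite_derive dh; ring]. }
  destruct (itv_inhabited lo hi Hlt) as [t0 Ht0].
  set (vx0 := a t0 - center_x T c lam mu (h t0 - s0)).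
  set (vy0 := b t0 - center_y T c lam mu (h t0 - s0)).
  assert (HXa : forall t, in_itv lo hi t -> a t = center_x T c lam mu (h t - s0) + vx0).
  { intros t Ht; enough (a t - center_x T c lam mu (h t - s0) = vx0) by lra.
    apply (itv_constant lo hi (fun t => a t - center_x T c lam mu (h t - s0))); trivial.
    apply (Hcenter a a1 (center_x T c lam mu) lam); trivial.
    intros; now apply center_x_derive. }
  assert (HXb : forall t, in_itv lo hi t -> b t = center_y T c lam mu (h t - s0) + vy0).
  { intros t Ht; enough (b t - center_y T c lam mu (h t - s0) = vy0) by lra.
    apply (itv_constant lo hi (fun t => b t - center_y T c lam mu (h t - s0))); trivial.
    apply (Hcenter b b1 (center_y T c lam mu) mu); trivial.
    intros; now apply center_y_derive. }
  exists jlo, jhi, (vx0, vy0, s0); split.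
  - split; [trivial|split; [trivial|split; [trivial|]]].
    intros s Hs; apply HJ in Hs; destruct Hs as (t & Ht & <-); auto.
  - intro p; split.
    + intros (t & th & Ht & ->); destruct (angle_sign_flip e th He) as (th' & Ec & Es).
      exists (h t - s0), th'; split; [apply HJ; now exists t|].
      unfold family_surface, circles, vsub, vadd, vscal, vx, vy, vz; cbn [fst snd].
      rewrite Ec, Es, (HXa t Ht), (HXb t Ht), (Hr t Ht); apply V3_eq; ring.
    + intros (s & th & Hs & Hp); apply HJ in Hs; destruct Hs as (t & Ht & <-).
      destruct (angle_sign_flip e th He) as (th' & Ec & Es).
      exists t, th'; split; trivial.
      destruct p as [[x y] z]; revert Hp.
      unfold family_surface, circles, vsub, vadd, vscal, vx, vy, vz; cbn [fst snd].
      intro Hp; injection Hp as Hx Hy Hz.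
      rewrite Ec, Es, (HXa t Ht), (HXb t Ht), (Hr t Ht); apply V3_eq.
      * transitivity (center_x T c lam mu (h t - s0) + vx0
          + e * e * (radius T c lam mu (h t - s0) * cos th)); [rewrite He; lra|ring].
      * transitivity (center_y T c lam mu (h t - s0) + vy0
          + e * e * (radius T c lam mu (h t - s0) * sin th)); [rewrite He; lra|ring].
      * lra.
Qed.

(** The equation for [r1] says [(ln r)' = - m * h'], so [h + ln r / m] is a constant [z0], and the
    height above [z0] is [- / m] times the logarithm of the distance to the axis. *)
Lemma log_surface_case (lo hi : Rbar) (h r h1 r1 : R -> R) (m x0 y0 : R) :
  Rbar_lt lo hi ->
  (forall t, in_itv lo hi t -> is_derive h t (h1 t)) ->
  (forall t, in_itv lo hi t -> is_derive r t (r1 t)) ->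
  (forall t, in_itv lo hi t -> 0 < r t) ->
  m <> 0 -> (forall t, in_itv lo hi t -> r1 t = - m * r t * h1 t) ->
  exists z0 c, c <> 0 /\
    forall t th, in_itv lo hi t ->
      translate (x0, y0, z0) (log_surface c) (x0 + r t * cos th, y0 + r t * sin th, h t).
Proof.
  intros Hlt Dh Dr r_pos m0 Hr1; destruct (itv_inhabited lo hi Hlt) as [t0 Ht0].
  set (z0 := h t0 + ln (r t0) / m).
  exists z0, (- / m); split.
  { apply Ropp_neq_0_compat; now apply Rinv_neq_0_compat. }
  intros t th Ht; assert (Hr := r_pos t Ht).
  assert (Hz : h t + ln (r t) / m = z0).
  { apply (itv_constant lo hi (fun t => h t + ln (r t) / m)); trivial.
    intros u Hu; assert (dh := Dh u Hu); assert (dr := Dr u Hu).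
    specialize (r_pos u Hu).
    auto_derive; [repeat split; try (eexists; eassumption); trivial|].
    rewrite_derive dh; rewrite_derive dr; rewrite (Hr1 u Hu); field; split; lra. }
  assert (CS := cos2_sin2 th).
  unfold translate, log_surface, vsub, vadd, vscal, vx, vy, vz; cbn [fst snd].
  replace (x0 + r t * cos th + -1 * x0) with (r t * cos th) by ring.
  replace (y0 + r t * sin th + -1 * y0) with (r t * sin th) by ring.
  split.
  - intro H; injection H as H1 H2.
    apply Rmult_integral in H1, H2; destruct H1 as [H1|H1], H2 as [H2|H2]; try lra.
    rewrite H1, H2 in CS; lra.
  - replace ((r t * cos th) ^ 2 + (r t * sin th) ^ 2) with (r t * r t).
    + rewrite sqrt_square by lra; rewrite <- Hz; field; trivial.
    + transitivity (r t * r t * (cos th * cos th + sin th * sin th)); [rewrite CS|]; ring.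
Qed.

Theorem theorem1p2 :
  (forall (lo hi : Rbar) (a b h r : R -> R) (Lambda : R),
     foliated_by_circles lo hi a b h r ->
     CAMC lo hi (circles a b h r) Lambda ->
     let Sigma := trace lo hi (circles a b h r) in
     (Lambda <> 0 -> exists x0 y0 : R, revolution_about x0 y0 Sigma) /\
     (Lambda = 0 ->
        (exists c : R, subset Sigma (horizontal_plane c)) \/
        (exists x0 y0 z0 c : R, c <> 0 /\
           revolution_about x0 y0 Sigma /\
           subset Sigma (translate (x0, y0, z0) (log_surface c))) \/
        (exists (T : solution_type) (c lam mu : R) (jlo jhi : Rbar) (v : V3),
           admissible T c lam mu jlo jhi /\
           same_set Sigma
             (translate v (trace jlo jhi (family_surface T c lam mu)))))) /\
  (forall (T : solution_type) (c lam mu : R) (lo hi : Rbar),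
     admissible T c lam mu lo hi ->
     let X := family_surface T c lam mu in
     CAMC lo hi X 0 /\
     embedded lo hi X /\
     exists al be de : R, (al, be) <> (0, 0) /\
       (forall s, in_itv lo hi s ->
          vertical_plane al be de (center_x T c lam mu s, center_y T c lam mu s, s)) /\
       symmetric_about al be de (trace lo hi X)).

Proof.
  split.
  - intros lo hi a b h r Lambda HF HC Sigma.
    pose proof HF as (Hlt & Sa & Sb & Sh & Sr & r_pos & _).
    destruct (itv_inhabited lo hi Hlt) as [t0 Ht0].
    split; intro HL.
    + exists (a t0), (b t0).
      apply (centers_fixed_revolution lo hi a b h r HF t0 Ht0).
      intros t Ht; now apply (camc_nonzero_case lo hi a b h r Lambda).
    + assert (HD : forall f, smooth_on lo hi f -> forall t, in_itv lo hi t ->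
        is_derive f t (Derive f t)).
      { intros f Hf t Ht; apply Derive_correct; exact (Hf t Ht 1%nat). }
      assert (HD2 : forall f, smooth_on lo hi f -> forall t, in_itv lo hi t ->
        is_derive (Derive f) t (Derive (Derive f) t)).
      { intros f Hf t Ht; apply Derive_correct; exact (Hf t Ht 2%nat). }
      assert (EQ := fun t Ht => camc_zero_case lo hi a b h r Lambda HF HC t Ht HL).
      destruct (height_dichotomy lo hi r (Derive a) (Derive b) (Derive h) (Derive r)
        (Derive (Derive a)) (Derive (Derive b)) (Derive (Derive h)) (Derive (Derive r)))
        as [H0|H0]; auto; try (intros t Ht; apply EQ; trivial).
      (* On a critical circle of the height, the immersion condition forbids zeros of [w]. *)
      { intros t Ht H; apply nonvanishing_on_circle; intros x y Hxy.
        now apply (immersed_w lo hi a b h r HF). }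
      { left; exists (h t0); intros p (t & th & Ht & ->).
        unfold horizontal_plane, circles, vadd, vscal, vx, vy, vz; cbn [fst snd].
        rewrite Rmult_0_r, Rplus_0_r; apply (itv_constant lo hi h); trivial.
        intros u Hu; rewrite <- (H0 u Hu); auto. }
      right.
      destruct (inverse_radius_system lo hi r (Derive a) (Derive b) (Derive h) (Derive r)
        (Derive (Derive a)) (Derive (Derive b)) (Derive (Derive h)) (Derive (Derive r)))
        as (lam & mu & E & Hsys); auto; try (intros t Ht; apply EQ; trivial).
      set (k := sqrt (lam ^ 2 + mu ^ 2)).
      assert (Hk : k ^ 2 = lam ^ 2 + mu ^ 2).
      { transitivity (k * k); [ring|apply sqrt_sqrt; nra]. }
      assert (Hcons := fun t Ht => proj1 (proj2 (proj2 (Hsys t Ht)))).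
      assert (Drho := fun t Ht => proj1 (proj2 (proj2 (proj2 (Hsys t Ht))))).
      assert (Dsg := fun t Ht => proj2 (proj2 (proj2 (proj2 (Hsys t Ht))))).
      cbv beta in Hcons, Drho, Dsg; rewrite <- Hk in Hcons.
      destruct (Req_dec k 0) as [k0|k0].
      * left.
        assert (Hlm : lam = 0 /\ mu = 0) by (rewrite k0 in Hk; split; nra).
        destruct Hlm as [-> ->].
        assert (Hfix : forall t, in_itv lo hi t -> Derive a t = 0 /\ Derive b t = 0).
        { intros t Ht; destruct (Hsys t Ht) as (Ea & Eb & _); rewrite Ea, Eb; split; ring. }
        destruct (centers_fixed_revolution lo hi a b h r HF t0 Ht0 Hfix) as [Hab Hrev].
        destruct (integrate_zero_k lo hi (Derive h) (fun t => / r t)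
          (fun t => - Derive r t / (r t ^ 2 * Derive h t)) E k Hlt Drho Dsg Hcons k0)
          as [m Hm].
        { intros t Ht; apply Rinv_neq_0_compat; specialize (r_pos t Ht); lra. }
        assert (Hr1 : forall t, in_itv lo hi t -> Derive r t = - m * r t * Derive h t).
        { intros t Ht; specialize (Hm t Ht); specialize (r_pos t Ht); specialize (H0 t Ht).
          transitivity (- (r t ^ 2 * Derive h t) * (m * / r t)); [|field; lra].
          rewrite <- Hm; field; split; [trivial|lra]. }
        (* With [m = 0] the radius would be constant as well, giving a vertical cylinder. *)
        assert (m0 : m <> 0).
        { intros ->; destruct (some_w_neq0 lo hi a b h r Lambda HF HC) as (t & x & y & Ht & Hw).
          apply Hw; destruct (Hfix t Ht) as [-> ->]; rewrite (Hr1 t Ht); ring. }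
        destruct (log_surface_case lo hi h r (Derive h) (Derive r) m (a t0) (b t0))
          as (z0 & c & c0 & Hlog); auto.
        exists (a t0), (b t0), z0, c; split; [trivial|split; [trivial|]].
        intros p (t & th & Ht & ->).
        replace (circles a b h r t th) with
          ((a t0 + r t * cos th, b t0 + r t * sin th, h t) : V3); [now apply Hlog|].
        destruct (Hab t Ht) as [<- <-].
        unfold circles, vadd, vscal, vx, vy, vz; cbn [fst snd]; apply V3_eq; ring.
      * right.
        assert (k_pos : 0 < k).
        { destruct (sqrt_pos (lam ^ 2 + mu ^ 2)) as [H|H]; [exact H|now symmetry in H]. }
        destruct (integrate_inverse_radius lo hi h (Derive h) (fun t => / r t)
          (fun t => - Derive r t / (r t ^ 2 * Derive h t)) E k)
          as (T & c & s0 & e & c0 & He & Hrho); auto.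
        destruct (circles_same_family lo hi a b h r (Derive a) (Derive b) (Derive h)
          T c lam mu s0 e) as (jlo & jhi & v & Hadm & Hsame); auto.
        { intros t Ht; apply Hsys, Ht. }
        { intros t Ht; apply Hsys, Ht. }
        { rewrite <- Hk; now apply pow_nonzero. }
        exists T, c, lam, mu, jlo, jhi, v; now split.
  - intros T c lam mu lo hi Hadm X.
    split; [now apply family_CAMC|split; [now apply family_embedded|]].
    exists mu, (- lam), 0; now apply family_symmetric.
Qed.
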